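(* Let $\{\{X_i^{(k)}\}_{i=1}^d,Z^{(k)}\}_{k\ge0}$ be a sequence generated by the FAPS algorithm (described in the context), started from $X_i^{(0)},Z^{(0)}\in\mathcal{S}_{n,p}$ with $$\left(\mathbf{d}_i^{(0)}\right)^2\le\frac{1}{\rho d},\quad i=1,\dots,d.$$ Assume that, for $i=1,\dots,d$, (i) $0\le\delta_i<\dfrac{\underline{\sigma}}{2\sqrt{\rho d}}$, and (ii) $\beta_i\ge\omega_i\|A\|_{\mathrm F}^2$. Then $\{Z^{(k)}\}$ has at least one accumulation point, and any accumulation point is a first-order stationary point of the problem $\min_{Z\in\mathcal{S}_{n,p}}-\frac12\mathrm{tr}(Z^\top AA^\top Z)$, i.e. a point $Z\in\mathcal{S}_{n,p}$ with $\mathbf{P}^\perp_ZAA^\top Z=0$. Moreover, there exists a constant $C>0$ such that for any $N>1$, $$\min_{k=0,\dots,N-1}\left\{\left\|\mathbf{P}^\perp_{Z^{(k)}}AA^\top Z^{(k)}\right\|_{\mathrm F}^2+\frac1d\sum_{i=1}^d\left(\mathbf{d}_i^{(k)}\right)^2\right\}\le\frac{C}{N}.$$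
   Context: Setting: $A=[A_1\;\cdots\;A_d]\in\mathbb{R}^{n\times m}$ with $A_i\in\mathbb{R}^{n\times m_i}$, $m_1+\dots+m_d=m$, $n\le m$. $\mathcal{S}_{n,p}=\{X\in\mathbb{R}^{n\times p}\mid X^\top X=I_p\}$; for $X,Y\in\mathcal{S}_{n,p}$, $\mathbf{P}_X=XX^\top$, $\mathbf{P}^\perp_X=I_n-XX^\top$, $\mathbf{D_p}(X,Y)=XX^\top-YY^\top$, $\mathbf{d_p}(X,Y)=\|\mathbf{D_p}(X,Y)\|_{\mathrm F}$. $\mathbf{orth}(M)$ is the set of orthonormal bases of the range of $M$. $\|\cdot\|_{\mathrm F}$, $\|\cdot\|_2$ are the Frobenius and spectral norms. Write $\mathbf{d}_i^{(k)}=\mathbf{d_p}(X_i^{(k)},Z^{(k)})$. FAPS algorithm. Parameters: penalty parameters $\beta_i>0$, constants $c_1,c_1'>0$ and $\delta_i\in[0,1)$ (independent of the $\beta_i$). Start from $X_i^{(0)},Z^{(0)}\in\mathcal{S}_{n,p}$. For all $k\ge0$ set $W_i^{(k)}=-\mathbf{P}^\perp_{X_i^{(k)}}A_iA_i^\top X_i^{(k)}$ and $\Lambda_i^{(k)}=X_i^{(k)}(W_i^{(k)})^\top+W_i^{(k)}(X_i^{(k)})^\top$. With $H_i^{(k)}=A_iA_i^\top+\Lambda_i^{(k)}+\beta_i\mathbf{P}_{Z^{(k)}}$ and $h_i^{(k)}(X)=-\frac12\mathrm{tr}(X^\top H_i^{(k)}X)$, client $i$ takes any $X_i^{(k+1)}\in\mathcal{S}_{n,p}$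 satisfying $h_i^{(k)}(X_i^{(k)})-h_i^{(k)}(X_i^{(k+1)})\ge\frac{c_1}{c_1'\|A_i\|_2^2+\beta_i}\|\mathbf{P}^\perp_{X_i^{(k)}}H_i^{(k)}X_i^{(k)}\|_{\mathrm F}^2$ and $\|\mathbf{P}^\perp_{X_i^{(k+1)}}H_i^{(k)}X_i^{(k+1)}\|_{\mathrm F}\le\delta_i\|\mathbf{P}^\perp_{X_i^{(k)}}H_i^{(k)}X_i^{(k)}\|_{\mathrm F}$. Then client $i$ computes $Y_i^{(k)}=Q_i^{(k)}Z^{(k)}$ with $Q_i^{(k)}=\beta_i\mathbf{P}_{X_i^{(k+1)}}-\Lambda_i^{(k+1)}$, and the center takes $Z^{(k+1)}\in\mathcal{S}_{n,p}$ with $Z^{(k+1)}\in\mathbf{orth}(\sum_{i=1}^dY_i^{(k)})$. Constants: $\rho=\max_{i,j=1,\dots,d}\{\beta_i/\beta_j\}\ge1$, $\underline{\sigma}=\sqrt{1-1/(2\rho d)}\in(0,1)$, and $$\omega_i=\max\left\{c_1',\;\frac{12\rho d\sqrt p}{c_1\underline{\sigma}^2},\;\frac{4\sqrt2(1+\sqrt{2\rho d})}{\underline{\sigma}-2\sqrt{\rho d}\,\delta_i},\;16\rho d\sqrt p,\;\frac{4(1+\sqrt{2\rho d})}{c_1\underline{\sigma}^2\rho d}\right\}.$$ *)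

(* Defs.v *)
From mathcomp Require Import all_boot all_order all_algebra.
From mathcomp Require Import all_classical all_reals all_analysis.

Set Implicit Arguments.
Unset Strict Implicit.
Unset Printing Implicit Defensive.

Import Order.TTheory GRing.Theory Num.Theory.
Import numFieldNormedType.Exports.

Local Open Scope classical_set_scope.
Local Open Scope ring_scope.

Definition frobenius_norm (R : realType) m n (M : 'M[R]_(m, n)) : R :=
  Num.sqrt (\sum_i \sum_j M i j ^+ 2).

(* Operator norm induced by the Euclidean norms.  The closed unit ball, rather
   than the unit sphere, keeps the set nonempty when [M] has no column. *)
Definition spectral_norm (R : realType) m n (M : 'M[R]_(m, n)) : R :=
  sup [set frobenius_norm (M *m x) |
       x in [set x : 'cV[R]_n | frobenius_norm x <= 1]].

Definition stiefel (R : realType) n p : set 'M[R]_(n, p) :=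
  [set X | X^T *m X = 1%:M].

Definition orthproj (R : realType) n p (X : 'M[R]_(n, p)) : 'M[R]_n :=
  X *m X^T.

Definition orthproj_perp (R : realType) n p (X : 'M[R]_(n, p)) : 'M[R]_n :=
  1%:M - X *m X^T.

Definition dist_proj (R : realType) n p (X Y : 'M[R]_(n, p)) : R :=
  frobenius_norm (X *m X^T - Y *m Y^T).

(* [%MS] compares row spaces, hence the transpositions: the columns of [Z] are
   an orthonormal basis of the range (column space) of [M]. *)
Definition orth (R : realType) n q p (M : 'M[R]_(n, q)) : set 'M[R]_(n, p) :=
  [set Z | @stiefel R n p Z /\ (Z^T == M^T)%MS].

Definition stationary_residual (R : realType) n m p (A : 'M[R]_(n, m))
    (Z : 'M[R]_(n, p)) : 'M[R]_(n, p) :=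
  orthproj_perp Z *m A *m A^T *m Z.

(* First-order stationarity for min - 1/2 tr(Z^T A A^T Z) over Z^T Z = I. *)
Definition first_order_stationary (R : realType) n m p (A : 'M[R]_(n, m))
    (Z : 'M[R]_(n, p)) : Prop :=
  stiefel Z /\ stationary_residual A Z = 0.

Definition faps_W (R : realType) n m p (Ai : 'M[R]_(n, m))
    (Xi : 'M[R]_(n, p)) : 'M[R]_(n, p) :=
  - (orthproj_perp Xi *m Ai *m Ai^T *m Xi).

Definition faps_Lambda (R : realType) n m p (Ai : 'M[R]_(n, m))
    (Xi : 'M[R]_(n, p)) : 'M[R]_n :=
  Xi *m (faps_W Ai Xi)^T + faps_W Ai Xi *m Xi^T.

Definition faps_H (R : realType) n m p (Ai : 'M[R]_(n, m)) (betai : R)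
    (Xi Z : 'M[R]_(n, p)) : 'M[R]_n :=
  Ai *m Ai^T + faps_Lambda Ai Xi + betai *: orthproj Z.

Definition local_objective (R : realType) n p (H : 'M[R]_n)
    (X : 'M[R]_(n, p)) : R :=
  - (2^-1 * \tr (X^T *m H *m X)).

Definition faps_client_step (R : realType) n m p (Ai : 'M[R]_(n, m))
    (betai c1 c1' deltai : R) (Xi Z Xi' : 'M[R]_(n, p)) : Prop :=
  let H := faps_H Ai betai Xi Z in
  let grad (X : 'M[R]_(n, p)) := frobenius_norm (orthproj_perp X *m H *m X) in
  [/\ stiefel Xi',
      local_objective H Xi - local_objective H Xi' >=
        c1 / (c1' * spectral_norm Ai ^+ 2 + betai) * grad Xi ^+ 2
    & grad Xi' <= deltai * grad Xi].

(* The dual variable entering Q is already the one of the new iterate [Xi']. *)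
Definition faps_Q (R : realType) n m p (Ai : 'M[R]_(n, m)) (betai : R)
    (Xi' : 'M[R]_(n, p)) : 'M[R]_n :=
  betai *: orthproj Xi' - faps_Lambda Ai Xi'.

Record FAPS_sequence (R : realType) (n p d : nat) (m : 'I_d -> nat)
    (A : forall i, 'M[R]_(n, m i)) (c1 c1' : R) (delta beta : 'I_d -> R)
    (X : nat -> 'I_d -> 'M[R]_(n, p)) (Z : nat -> 'M[R]_(n, p)) : Prop := {
  faps_X0 : forall i, stiefel (X 0%N i);
  faps_Z0 : stiefel (Z 0%N);
  faps_client : forall k i,
    faps_client_step (A i) (beta i) c1 c1' (delta i) (X k i) (Z k) (X k.+1 i);
  faps_center : forall k,
    orth (\sum_i faps_Q (A i) (beta i) (X k.+1 i) *m Z k) (Z k.+1)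
}.

(* For positive [beta] the ratios are positive, so the default value 0 of the
   maximum is immaterial as soon as [d > 0]. *)
Definition penalty_ratio (R : realType) d (beta : 'I_d -> R) : R :=
  \big[Num.max/0]_i \big[Num.max/0]_j (beta i / beta j).

Definition sigma_lower (R : realType) d (beta : 'I_d -> R) : R :=
  Num.sqrt (1 - 1 / (2 * penalty_ratio beta * d%:R)).

Definition omega (R : realType) (p d : nat) (c1 c1' : R)
    (beta : 'I_d -> R) (deltai : R) : R :=
  let rd := penalty_ratio beta * d%:R in
  let sigma := sigma_lower beta in
  Num.max c1'
  (Num.max (12 * rd * Num.sqrt p%:R / (c1 * sigma ^+ 2))
  (Num.max (4 * Num.sqrt 2 * (1 + Num.sqrt (2 * rd))
              / (sigma - 2 * Num.sqrt rd * deltai))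
  (Num.max (16 * rd * Num.sqrt p%:R)
           (4 * (1 + Num.sqrt (2 * rd)) / (c1 * sigma ^+ 2 * rd))))).

Definition faps_measure (R : realType) n m p d (A : 'M[R]_(n, m))
    (X : nat -> 'I_d -> 'M[R]_(n, p)) (Z : nat -> 'M[R]_(n, p)) (k : nat) : R :=
  frobenius_norm (stationary_residual A (Z k)) ^+ 2
  + d%:R^-1 * \sum_i dist_proj (X k i) (Z k) ^+ 2.

(* Main.v *)
(* Write P and Q for the projectors of a client iterate X and of the center
   iterate Z, J = 2 P - 1 and S = A_i A_i^T.  Then Lambda(X) = - (S - J S J) / 2,
   so S + Lambda(X) = (S + J S J) / 2 commutes with P and Lambda is Lipschitz in
   P.  Hence the projected gradient of the client problem at X is beta times
   (1 - P) Q X, whose squared norm lies between t (1 - t) and t for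
   t = d_p(X, Z)^2 / 2.  The sufficient decrease and the inexactness criterion
   then give d_p(X', Z) <= 2 / (3 sqrt (rho d)) d_p(X, Z), and the sum over the
   clients of the augmented Lagrangians of X X^T = Z Z^T drops by a multiple of
   the sum of the d_p(X, Z)^2, the change of Lambda being absorbed by large beta.

   For the center step from Q to Q', the relation M Q = Q' M Q gives
   tr (M (Q' - Q)) = tr (M (Q' - Q)^2), which is at least a multiple of
   |Q' - Q|^2 because the projectors of the clients are close to Q.  The same
   identity propagates d_p(X_i, Z)^2 <= 1 / (rho d), and the stationarity residual
   at Z is bounded by |Q' - Q| plus the d_p(X_i, Z), so that the optimality measure
   is bounded by a multiple of the decrease of the potential and is summable. *)
Require Import Defs.
From mathcomp Require Import all_boot all_order all_algebra.
From mathcomp Require Import all_classical all_reals all_analysis.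
From mathcomp Require Import ring lra.
Import Order.TTheory GRing.Theory Num.Theory.
Import numFieldNormedType.Exports.
Local Open Scope classical_set_scope.
Local Open Scope ring_scope.

Set Implicit Arguments.
Unset Strict Implicit.
Unset Printing Implicit Defensive.

Local Notation nF := frobenius_norm.

(** * Frobenius norm *)

Section FrobeniusNorm.
Variable R : realType.

Lemma frobenius_norm_ge0 m n (M : 'M[R]_(m, n)) : 0 <= nF M.
Proof. exact: sqrtr_ge0. Qed.

Lemma frobenius_normE m n (M : 'M[R]_(m, n)) :
  nF M ^+ 2 = \sum_i \sum_j M i j ^+ 2.
Proof.
by rewrite sqr_sqrtr//; apply: sumr_ge0 => i _; apply: sumr_ge0 => j _; exact: sqr_ge0.
Qed.

Lemma frobenius_norm_sqr m n (M : 'M[R]_(m, n)) : nF M ^+ 2 = \tr (M^T *m M).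
Proof.
rewrite frobenius_normE exchange_big /=; apply: eq_bigr => j _.
by rewrite !mxE; apply: eq_bigr => i _; rewrite !mxE expr2.
Qed.

Lemma mxtrace_tr_mul m n (M N : 'M[R]_(m, n)) : \tr (M^T *m N) = \tr (N^T *m M).
Proof. by rewrite -mxtrace_tr trmx_mul trmxK. Qed.

Lemma frobenius_norm_eq0 m n (M : 'M[R]_(m, n)) : nF M = 0 -> M = 0.
Proof.
move=> M0; apply/matrixP => i j; rewrite mxE; apply/eqP; rewrite -sqrf_eq0.
have /eqP := frobenius_normE M; rewrite M0 expr0n/= eq_sym psumr_eq0; last first.
  by move=> k _; apply: sumr_ge0 => l _; exact: sqr_ge0.
move=> /allP/(_ i); rewrite mem_index_enum => /(_ isT)/=.
rewrite psumr_eq0; last by move=> k _; exact: sqr_ge0.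
by move=> /allP/(_ j); rewrite mem_index_enum; exact.
Qed.

Lemma frobenius_norm_eq m n q r (M : 'M[R]_(m, n)) (N : 'M[R]_(q, r)) :
  nF M ^+ 2 = nF N ^+ 2 -> nF M = nF N.
Proof.
by move/eqP; rewrite eqrXn2// ?frobenius_norm_ge0// => /eqP.
Qed.

Lemma frobenius_norm_le m n q r (M : 'M[R]_(m, n)) (N : 'M[R]_(q, r)) :
  nF M ^+ 2 <= nF N ^+ 2 -> nF M <= nF N.
Proof. by rewrite ler_sqr// nnegrE frobenius_norm_ge0. Qed.

Lemma frobenius_normZ m n (a : R) (M : 'M[R]_(m, n)) : nF (a *: M) = `|a| * nF M.
Proof.
apply/eqP; rewrite -(@eqrXn2 _ 2)// ?mulr_ge0 ?frobenius_norm_ge0//.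
rewrite exprMn !frobenius_norm_sqr [(_ *: _)^T]linearZ/= -scalemxAl -scalemxAr !mxtraceZ.
by rewrite real_normK ?num_real// mulrA expr2.
Qed.

Lemma frobenius_normN m n (M : 'M[R]_(m, n)) : nF (- M) = nF M.
Proof. by rewrite -scaleN1r frobenius_normZ normrN1 mul1r. Qed.

Lemma frobenius_norm0 m n : nF (0 : 'M[R]_(m, n)) = 0.
Proof. by rewrite -(scale0r 0) frobenius_normZ normr0 mul0r. Qed.

Lemma frobenius_norm_tr m n (M : 'M[R]_(m, n)) : nF M^T = nF M.
Proof.
by apply: frobenius_norm_eq; rewrite !frobenius_norm_sqr trmxK mxtrace_mulC.
Qed.

Lemma frobenius_normC m n (M N : 'M[R]_(m, n)) : nF (M - N) = nF (N - M).
Proof. by rewrite -frobenius_normN opprB. Qed.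

Lemma frobenius_norm_sqrD m n (M N : 'M[R]_(m, n)) :
  nF (M + N) ^+ 2 = nF M ^+ 2 + nF N ^+ 2 + 2 * \tr (M^T *m N).
Proof.
rewrite !frobenius_norm_sqr [(_ + _)^T]linearD/= mulmxDl !mulmxDr !mxtraceD (mxtrace_tr_mul N).
by lra.
Qed.

Lemma frobenius_norm_sqrB m n (M N : 'M[R]_(m, n)) :
  nF (M - N) ^+ 2 = nF M ^+ 2 + nF N ^+ 2 - 2 * \tr (M^T *m N).
Proof. by rewrite frobenius_norm_sqrD frobenius_normN mulmxN linearN/= mulrN. Qed.

Lemma frobenius_cauchy_schwarz m n (M N : 'M[R]_(m, n)) :
  \tr (M^T *m N) <= nF M * nF N.
Proof.
have [M0|M0] := eqVneq (nF M) 0.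
  by rewrite M0 (frobenius_norm_eq0 M0) trmx0 mul0mx mxtrace0 mul0r.
have [N0|N0] := eqVneq (nF N) 0.
  by rewrite N0 (frobenius_norm_eq0 N0) mulmx0 mxtrace0 mulr0.
have gt0 : 0 < nF M * nF N by rewrite mulr_gt0// lt0r ?M0 ?N0 frobenius_norm_ge0.
have := sqr_ge0 (nF (nF N *: M - nF M *: N)).
rewrite frobenius_norm_sqrB !frobenius_normZ !ger0_norm ?frobenius_norm_ge0//.
rewrite [(_ *: _)^T]linearZ/= -scalemxAl -scalemxAr !mxtraceZ => h.
by rewrite -(ler_pM2l gt0); nra.
Qed.

Lemma frobenius_cauchy_schwarz_norm m n (M N : 'M[R]_(m, n)) :
  `|\tr (M^T *m N)| <= nF M * nF N.
Proof.
rewrite ler_norml frobenius_cauchy_schwarz andbT lerNl.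
by rewrite -linearN/= -mulNmx -linearN/= -(frobenius_normN M) frobenius_cauchy_schwarz.
Qed.

Lemma frobenius_normD m n (M N : 'M[R]_(m, n)) : nF (M + N) <= nF M + nF N.
Proof.
rewrite -ler_sqr ?nnegrE ?addr_ge0 ?frobenius_norm_ge0//.
by rewrite frobenius_norm_sqrD; have := frobenius_cauchy_schwarz M N; nra.
Qed.

Lemma frobenius_normB m n (M N : 'M[R]_(m, n)) : nF (M - N) <= nF M + nF N.
Proof. by rewrite -(frobenius_normN N) frobenius_normD. Qed.

Lemma frobenius_norm_sum m n (I : finType) (M : I -> 'M[R]_(m, n)) :
  nF (\sum_i M i) <= \sum_i nF (M i).
Proof.
elim/big_rec2: _ => [|i x y _ h]; first by rewrite frobenius_norm0.
by rewrite (le_trans (frobenius_normD _ _))// lerD2l.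
Qed.

Lemma frobenius_normM m n q (M : 'M[R]_(m, n)) (N : 'M[R]_(n, q)) :
  nF (M *m N) <= nF M * nF N.
Proof.
rewrite -ler_sqr ?nnegrE ?mulr_ge0 ?frobenius_norm_ge0// exprMn.
rewrite -(frobenius_norm_tr N) !frobenius_normE mulr_suml; apply: ler_sum => i _.
rewrite mulr_sumr; apply: ler_sum => j _.
have -> : (M *m N) i j = \tr ((row i M)^T^T *m (col j N)).
  by rewrite trmxK /mxtrace big_ord1 !mxE; apply: eq_bigr => k _; rewrite !mxE.
have h := frobenius_cauchy_schwarz_norm (row i M)^T (col j N).
have /le_trans -> // : \tr ((row i M)^T^T *m col j N) ^+ 2
    <= (nF (row i M)^T * nF (col j N)) ^+ 2.
  by rewrite -(@real_normK _ (\tr _)) ?num_real// lerXn2r// ?nnegrE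
    ?mulr_ge0 ?frobenius_norm_ge0.
rewrite exprMn frobenius_norm_tr !frobenius_normE !big_ord1.
rewrite (eq_bigr (fun k => M i k ^+ 2)); last by move=> k _; rewrite mxE.
under [X in _ * X <= _]eq_bigr => k _ do rewrite big_ord1 mxE.
by under [X in _ <= _ * X]eq_bigr => k _ do rewrite mxE.
Qed.

(** The vector 0 puts the value 0 in the set, which gives nonemptiness and the lower bound;
    submultiplicativity of the Frobenius norm gives the upper bound. *)
Lemma spectral_norm_le m n (M : 'M[R]_(m, n)) : 0 <= spectral_norm M <= nF M.
Proof.
have ub : ubound [set nF (M *m x) | x in [set x : 'cV[R]_n | nF x <= 1]] (nF M).
  move=> _ [x /= x1 <-]; apply: (le_trans (frobenius_normM _ _)).
  by rewrite -[leRHS]mulr1 ler_wpM2l ?frobenius_norm_ge0.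
have m0 : [set nF (M *m x) | x in [set x : 'cV[R]_n | nF x <= 1]] 0.
  by exists 0; rewrite /= ?mulmx0 frobenius_norm0.
apply/andP; split; first by apply: sup_ubound => //; exists (nF M).
by apply: sup_le_ub => //; exists 0.
Qed.

End FrobeniusNorm.

(** * Orthogonal projectors *)

Section OrthogonalProjectors.
Variables (R : realType) (n : nat).
Implicit Types P Q S T M : 'M[R]_n.

Definition orth_projector P := P^T = P /\ P *m P = P.

Lemma orthproj_projector p (X : 'M[R]_(n, p)) :
  stiefel X -> orth_projector (orthproj X).
Proof.
rewrite /stiefel/= /orthproj => hX; split; first by rewrite trmx_mul trmxK.
by rewrite mulmxA -(mulmxA X) hX mulmx1.
Qed.

Lemma mxtrace_orthproj p (X : 'M[R]_(n, p)) :
  stiefel X -> \tr (orthproj X) = p%:R.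
Proof. by rewrite /stiefel/= /orthproj mxtrace_mulC => ->; rewrite mxtrace1. Qed.

Lemma orth_projectorC P : orth_projector P -> orth_projector (1%:M - P).
Proof.
move=> [sP PP]; split; first by rewrite linearB/= trmx1 sP.
by rewrite mulmxBl mul1mx mulmxBr mulmx1 PP subrr subr0.
Qed.

Lemma projector_mulC P : orth_projector P -> P *m (1%:M - P) = 0.
Proof. by move=> [_ PP]; rewrite mulmxBr mulmx1 PP subrr. Qed.

Lemma projectorC_mul P : orth_projector P -> (1%:M - P) *m P = 0.
Proof. by move=> [_ PP]; rewrite mulmxBl mul1mx PP subrr. Qed.

Lemma frobenius_norm_projector P : orth_projector P -> nF P ^+ 2 = \tr P.
Proof. by move=> [sP PP]; rewrite frobenius_norm_sqr sP PP. Qed.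

Lemma frobenius_norm_mulmx_projector m (M : 'M[R]_(m, n)) P :
  orth_projector P -> nF (M *m P) ^+ 2 = \tr (M *m P *m M^T).
Proof.
move=> [sP PP]; rewrite frobenius_norm_sqr trmx_mul sP mxtrace_mulC.
by rewrite !mulmxA -(mulmxA M P P) PP.
Qed.

Lemma projector_pythagoras m (M : 'M[R]_(m, n)) P : orth_projector P ->
  nF (M *m P) ^+ 2 + nF (M *m (1%:M - P)) ^+ 2 = nF M ^+ 2.
Proof.
move=> hP; rewrite !frobenius_norm_mulmx_projector//; last exact: orth_projectorC.
rewrite -mxtraceD -mulmxDl -mulmxDr addrC subrK mulmx1.
by rewrite -(frobenius_norm_tr M) frobenius_norm_sqr trmxK.
Qed.

Lemma frobenius_norm_projectorr m (M : 'M[R]_(m, n)) P :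
  orth_projector P -> nF (M *m P) <= nF M.
Proof.
move=> /(projector_pythagoras M) hP; apply: frobenius_norm_le; rewrite -hP.
by rewrite lerDl sqr_ge0.
Qed.

Lemma frobenius_norm_projectorl m (M : 'M[R]_(n, m)) P :
  orth_projector P -> nF (P *m M) <= nF M.
Proof.
move=> hP; rewrite -frobenius_norm_tr -(frobenius_norm_tr M) trmx_mul.
by rewrite hP.1; exact: frobenius_norm_projectorr.
Qed.

(** Turns estimates on [n x p] matrices into estimates on projectors, which do not depend on the
    chosen basis. *)
Lemma frobenius_norm_mul_stiefel m p (M : 'M[R]_(m, n)) (X : 'M[R]_(n, p)) :
  stiefel X -> nF (M *m orthproj X) = nF (M *m X).
Proof.
move=> hX; apply: frobenius_norm_eq.
rewrite frobenius_norm_mulmx_projector; last exact: orthproj_projector.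
by rewrite frobenius_norm_sqr [RHS]mxtrace_mulC trmx_mul /orthproj !mulmxA.
Qed.

Lemma projector_dist_sqr P Q : orth_projector P -> orth_projector Q ->
  nF (P - Q) ^+ 2 = \tr P + \tr Q - 2 * \tr (P *m Q).
Proof.
move=> hP hQ; rewrite frobenius_norm_sqrB !frobenius_norm_projector//.
by case: (hP) => ->.
Qed.

(** The left-hand side is [tr ((1 - P) Q) = tr Q - tr (P Q)]; equal traces make this half of the
    squared distance. *)
Lemma frobenius_norm_projectorC_mul P Q : orth_projector P -> orth_projector Q ->
  \tr P = \tr Q -> nF ((1%:M - P) *m Q) ^+ 2 = nF (P - Q) ^+ 2 / 2.
Proof.
move=> hP hQ trPQ; rewrite projector_dist_sqr// trPQ.
rewrite frobenius_norm_mulmx_projector// linearB/= trmx1; case: (hP) => -> PP.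
rewrite mxtrace_mulC mulmxA (orth_projectorC hP).2 mulmxBl mul1mx linearB/=.
by lra.
Qed.

(* Writing [t] for half the squared distance, i.e. the sum of the squared sines
   of the principal angles, these are [t * (1 - t)] and [t]. *)
Lemma projector_residual_bounds P Q : orth_projector P -> orth_projector Q ->
  \tr P = \tr Q ->
  nF (P - Q) ^+ 2 / 2 * (1 - nF (P - Q) ^+ 2 / 2)
    <= nF ((1%:M - P) *m Q *m P) ^+ 2 <= nF (P - Q) ^+ 2 / 2.
Proof.
move=> hP hQ trPQ; rewrite -(frobenius_norm_projectorC_mul hP hQ trPQ).
set U := _ *m Q; apply/andP; split; last first.
  by rewrite lerXn2r ?nnegrE ?frobenius_norm_ge0// frobenius_norm_projectorr.
have := projector_pythagoras U hP.
(* Since [|U (1 - P)| = |U U^T| <= |U|^2], Pythagoras leaves at least [|U|^2 - |U|^4] for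
   [|U P|^2]. *)
have <- : U *m U^T = U *m (1%:M - P).
  rewrite /U trmx_mul (orth_projectorC hP).1 hQ.1 !mulmxA -(mulmxA _ Q Q).
  by rewrite hQ.2.
have := frobenius_normM U U^T; rewrite frobenius_norm_tr.
rewrite -(@ler_sqr _ (nF (U *m _))) ?nnegrE ?mulr_ge0 ?frobenius_norm_ge0//.
by nra.
Qed.

(** * Reflections and the off-diagonal part of a matrix with respect to a projector *)

Lemma projector_reflection P : orth_projector P ->
  (2 *: P - 1%:M)^T = 2 *: P - 1%:M /\ (2 *: P - 1%:M) *m (2 *: P - 1%:M) = 1%:M.
Proof.
move=> [sP PP]; split; first by rewrite linearB/= linearZ/= trmx1 sP.
rewrite mulmxBl mulmxBr mulmx1 mul1mx -scalemxAl -scalemxAr PP.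
by apply/matrixP => i j; rewrite !mxE; ring.
Qed.

Lemma frobenius_norm_orthogonall m (J : 'M[R]_n) (M : 'M[R]_(n, m)) :
  J^T *m J = 1%:M -> nF (J *m M) = nF M.
Proof.
move=> hJ; apply: frobenius_norm_eq; rewrite !frobenius_norm_sqr trmx_mul.
by rewrite mulmxA -(mulmxA M^T) hJ mulmx1.
Qed.

Lemma frobenius_norm_orthogonalr m (J : 'M[R]_n) (M : 'M[R]_(m, n)) :
  J *m J^T = 1%:M -> nF (M *m J) = nF M.
Proof.
move=> hJ; rewrite -frobenius_norm_tr trmx_mul frobenius_norm_orthogonall ?trmxK//.
exact: frobenius_norm_tr.
Qed.

(** The sign makes [S + offdiag P S] the block-diagonal part of [S] for the splitting given by [P]
    and [1 - P]. *)
Definition offdiag P S := - (P *m S *m (1%:M - P) + (1%:M - P) *m S *m P).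

Lemma faps_LambdaE m p (A : 'M[R]_(n, m)) (X : 'M[R]_(n, p)) :
  faps_Lambda A X = offdiag (orthproj X) (A *m A^T).
Proof.
rewrite /faps_Lambda /faps_W /offdiag /orthproj_perp /orthproj.
rewrite linearN/= mulmxN mulNmx -opprD !trmx_mul !trmxK linearB/= trmx1.
by rewrite trmx_mul trmxK !mulmxA.
Qed.

Lemma tr_offdiag P S : orth_projector P -> S^T = S -> (offdiag P S)^T = offdiag P S.
Proof.
move=> hP hS; rewrite /offdiag linearN/= linearD/= !trmx_mul (orth_projectorC hP).1.
by rewrite hS hP.1 addrC !mulmxA.
Qed.

(* [2 P - 1] is orthogonal, so both the off-diagonal and the diagonal part of
   [S] with respect to [P] are averages of matrices of norm [nF S]. *)
Lemma offdiag_reflection P S :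
  offdiag P S = - 2^-1 *: (S - (2 *: P - 1%:M) *m S *m (2 *: P - 1%:M)).
Proof.
rewrite /offdiag !(mulmxBl, mulmxBr, mul1mx, mulmx1) -!(scalemxAl, scalemxAr).
by apply/matrixP => i j; rewrite !mxE; field.
Qed.

Lemma frobenius_norm_conj_reflection P S : orth_projector P ->
  nF ((2 *: P - 1%:M) *m S *m (2 *: P - 1%:M)) = nF S.
Proof.
move=> /projector_reflection[sJ JJ].
by rewrite frobenius_norm_orthogonalr ?frobenius_norm_orthogonall// sJ.
Qed.

Lemma frobenius_norm_offdiag P S : orth_projector P -> nF (offdiag P S) <= nF S.
Proof.
move=> hP; rewrite offdiag_reflection frobenius_normZ normrN ger0_norm ?invr_ge0//.
have := frobenius_normB S ((2 *: P - 1%:M) *m S *m (2 *: P - 1%:M)).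
by rewrite frobenius_norm_conj_reflection//; lra.
Qed.

Lemma frobenius_norm_addr_offdiag P S :
  orth_projector P -> nF (S + offdiag P S) <= nF S.
Proof.
move=> hP; rewrite offdiag_reflection.
have -> : S + - 2^-1 *: (S - (2 *: P - 1%:M) *m S *m (2 *: P - 1%:M)) =
    2^-1 *: (S + (2 *: P - 1%:M) *m S *m (2 *: P - 1%:M)).
  by apply/matrixP => i j; rewrite !mxE; field.
rewrite frobenius_normZ ger0_norm ?invr_ge0//.
have := frobenius_normD S ((2 *: P - 1%:M) *m S *m (2 *: P - 1%:M)).
by rewrite frobenius_norm_conj_reflection//; lra.
Qed.

(** For the reflections [J] and [K], the difference is half of [J S J - K S K = (J - K) S J + K S (J
    - K)]; here [J - K = 2 (P - Q)], and the orthogonal outer factors preserve norms. *)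
Lemma offdiag_lipschitz P Q S : orth_projector P -> orth_projector Q ->
  nF (offdiag P S - offdiag Q S) <= 2 * nF S * nF (P - Q).
Proof.
move=> /projector_reflection[sJ JJ] /projector_reflection[sK KK].
rewrite !offdiag_reflection.
set J := 2 *: P - _ in sJ JJ *; set K := 2 *: Q - _ in sK KK *.
have -> : - 2^-1 *: (S - J *m S *m J) - - 2^-1 *: (S - K *m S *m K) =
    (P - Q) *m S *m J + K *m S *m (P - Q).
  have -> : P - Q = 2^-1 *: (J - K).
    by apply/matrixP => i j; rewrite !mxE; field.
  rewrite -!(scalemxAl, scalemxAr) !(mulmxBl, mulmxBr).
  by apply/matrixP => i j; rewrite !mxE; field.
apply: (le_trans (frobenius_normD _ _)).
rewrite (@frobenius_norm_orthogonalr _ J) ?sJ// -(mulmxA K).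
rewrite (@frobenius_norm_orthogonall _ K) ?sK//.
have := frobenius_normM (P - Q) S; have := frobenius_normM S (P - Q).
by lra.
Qed.

(** Block-diagonality of the corrected matrix: this is why [A A^T] and Lambda together drop out of
    the client gradient at the current iterate. *)
Lemma projectorC_addr_offdiag_mul P S : orth_projector P ->
  (1%:M - P) *m (S + offdiag P S) *m P = 0.
Proof.
move=> hP; have := projectorC_mul hP; have := (orth_projectorC hP).2.
rewrite /offdiag; move: (1%:M - P) => C CC CP.
rewrite mulmxDr mulmxDl mulmxN mulmxDr !mulmxA CP CC !mul0mx add0r mulNmx.
by rewrite -(mulmxA _ P P) hP.2 subrr.
Qed.

(** The same block vanishes when [Q] is [P], so subtracting it leaves only terms with a factor
    [Q - P]. This controls the part of the client gradient other than the penalty at the new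
    iterate. *)
Lemma frobenius_norm_mul_addr_offdiag P Q S :
  orth_projector P -> orth_projector Q ->
  nF ((1%:M - Q) *m (S + offdiag P S) *m Q) <= 2 * nF S * nF (Q - P).
Proof.
move=> hP hQ; have hT := projectorC_addr_offdiag_mul S hP.
have := frobenius_norm_addr_offdiag S hP.
move: (S + _) hT => T hT le_TS.
have -> : (1%:M - Q) *m T *m Q =
    (1%:M - Q) *m (T *m (Q - P)) - (Q - P) *m (T *m P).
  rewrite -[LHS]subr0 -hT !(mulmxBl, mulmxBr, mul1mx, mulmx1) !mulmxA.
  by apply/matrixP => i j; rewrite !mxE; ring.
apply: (le_trans (frobenius_normB _ _)).
have h1 := frobenius_norm_projectorl (T *m (Q - P)) (orth_projectorC hQ).
have h2 := frobenius_normM (Q - P) (T *m P).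
have h3 := frobenius_norm_projectorr T hP.
have h4 := frobenius_normM T (Q - P).
have := frobenius_norm_ge0 (Q - P); have := frobenius_norm_ge0 T.
by nra.
Qed.

(* The center matrix is indefinite; the square on the right still makes the gain
   of a step of orthogonal iteration positive once [Q] is positive near [P]. *)
Lemma orthogonal_iteration_gain (Q P P' : 'M[R]_n) : Q^T = Q ->
  orth_projector P -> orth_projector P' -> Q *m P = P' *m Q *m P ->
  \tr (Q *m (P' - P)) = \tr (Q *m ((P' - P) *m (P' - P))).
Proof.
move=> sQ hP hP' hQ.
(* Cyclicity of the trace moves [P'] in front of [Q P], which it fixes; transposition handles the
   other mixed product in the expansion of the square. *)
have e1 : \tr (Q *m (P *m P')) = \tr (Q *m P).
  by rewrite mulmxA mxtrace_mulC mulmxA -hQ.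
have e2 : \tr (Q *m (P' *m P)) = \tr (Q *m P).
  by rewrite -e1 -mxtrace_tr !trmx_mul sQ hP.1 hP'.1 mxtrace_mulC.
rewrite mulmxBl !mulmxBr hP.2 hP'.2 !linearB/= e1 e2; lra.
Qed.

(** Both sides equal [P - P P' P]. Hence the squared difference is block-diagonal for [P], which
    removes a cross term in the next bound. *)
Lemma projector_diff_sqr_comm P P' : orth_projector P -> orth_projector P' ->
  P *m ((P' - P) *m (P' - P)) = (P' - P) *m (P' - P) *m P.
Proof.
move=> hP hP'.
rewrite !(mulmxBl, mulmxBr) hP.2 hP'.2 !mulmxA hP.2 -!(mulmxA _ P P) !hP.2.
by apply/matrixP => i j; rewrite !mxE; ring.
Qed.

(** The trace is [|D Q|^2] with [D = P' - P]. The pieces [D P Q] and [D (1 - P) Q] are orthogonal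
    since [D^2] commutes with [P]; the first has squared norm at least
    [|D P|^2 (1 - |P (1 - Q)|^2)], and the second is dropped. *)
Lemma projector_gain_lower_bound Q P P' :
  orth_projector Q -> orth_projector P -> orth_projector P' ->
  \tr Q = \tr P -> \tr P' = \tr P ->
  (1 - nF (Q - P) ^+ 2 / 2) * (nF (P' - P) ^+ 2 / 2)
    <= \tr (Q *m ((P' - P) *m (P' - P))).
Proof.
move=> hQ hP hP' trQ trP'; have comm := projector_diff_sqr_comm hP hP'.
set D := P' - P in comm *.
have sD : D^T = D by rewrite /D linearB/= hP.1 hP'.1.
have -> : \tr (Q *m (D *m D)) = nF (D *m Q) ^+ 2.
  by rewrite frobenius_norm_mulmx_projector// sD mulmxA mxtrace_mulC mulmxA mxtrace_mulC mulmxA.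
have -> : D *m Q = D *m P *m Q + D *m (1%:M - P) *m Q.
  by rewrite -mulmxDl -mulmxDr addrC subrK mulmx1.
rewrite (frobenius_norm_sqrD (D *m P *m Q)).
have -> : \tr ((D *m P *m Q)^T *m (D *m (1%:M - P) *m Q)) = 0.
  rewrite !trmx_mul sD hP.1 -!mulmxA (mulmxA D D) (mulmxA P) comm -!mulmxA.
  by rewrite (mulmxA P) projector_mulC// mul0mx !mulmx0 mxtrace0.
(* [D P = - (1 - P') P], so [P] carries exactly half of the squared norm of [D]. *)
have eDP : nF (D *m P) ^+ 2 = nF D ^+ 2 / 2.
  rewrite /D -frobenius_norm_projectorC_mul// mulmxBl hP.2 -frobenius_normN.
  by rewrite opprB mulmxBl mul1mx.
have := projector_pythagoras (D *m P) hQ.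
have : nF (D *m P *m (1%:M - Q)) <= nF (D *m P) * nF (P *m (1%:M - Q)).
  by rewrite -{1}hP.2 mulmxA -(mulmxA (D *m P)) frobenius_normM.
have -> : nF (P *m (1%:M - Q)) = nF ((1%:M - Q) *m P).
  by rewrite -frobenius_norm_tr trmx_mul hP.1 (orth_projectorC hQ).1.
rewrite -ler_sqr ?nnegrE ?mulr_ge0 ?frobenius_norm_ge0// exprMn.
rewrite (frobenius_norm_projectorC_mul hQ hP trQ) eDP.
by have := sqr_ge0 (nF (D *m (1%:M - P) *m Q)); lra.
Qed.

Lemma projector_dist_le P Q : orth_projector P -> orth_projector Q ->
  \tr P = \tr Q -> nF (P - Q) ^+ 2 <= 2 * \tr Q.
Proof.
move=> hP hQ trPQ; rewrite projector_dist_sqr// trPQ.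
suff : 0 <= \tr (P *m Q) by lra.
rewrite -{1}hP.2 -mulmxA mxtrace_mulC -{2}hP.1.
by rewrite -frobenius_norm_mulmx_projector// sqr_ge0.
Qed.

End OrthogonalProjectors.

(** * Scalar estimates for one client update *)

Section Scalars.
Variable R : realType.
Implicit Types a b c d e f g r s u v w q : R.

Lemma ler_sqr_nneg a b : 0 <= b -> a ^+ 2 <= b ^+ 2 -> a <= b.
Proof. by move=> b0 ab; rewrite leNgt; apply/negP => ba; nra. Qed.

(** Rational bounds let the scalar estimates below be closed by linear arithmetic; [client_decrease]
    uses the lower bound 4/3 exactly. *)
Lemma sqrt2_bounds : 4 / 3 <= (Num.sqrt 2 : R) <= 3 / 2.
Proof.
have w0 : 0 <= (Num.sqrt 2 : R) by exact: sqrtr_ge0.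
have ww : Num.sqrt 2 ^+ 2 = 2 :> R by rewrite sqr_sqrtr.
by apply/andP; split; apply: ler_sqr_nneg; lra.
Qed.

(* [d], [e], [f] are the distances [X-Z], [X'-Z], [X'-X]; [g], [g'] the norms of
   the projected gradients divided by [beta]; [a] bounds the squared norm of A. *)
Lemma client_contraction (a beta delta r s q w u d e f g g' : R) :
  0 <= a -> 0 < beta -> 0 <= delta -> 1 <= r -> 0 <= q -> q ^+ 2 = r ->
  0 < s -> s ^+ 2 = 1 - 1 / (2 * r) -> w ^+ 2 = 2 -> 4 / 3 <= w <= 3 / 2 ->
  0 <= u -> 0 <= d -> 0 <= e -> 0 <= g' ->
  4 * w * (1 + w * q) * a <= beta * (s - 2 * q * delta) ->
  16 * r * u * a <= beta ->
  r * d ^+ 2 <= 1 -> f <= e + d -> f <= w * u ->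
  0 <= a * f / 2 + beta / 4 * (d ^+ 2 - e ^+ 2) ->
  g <= d / w -> e ^+ 2 / 2 * (1 - e ^+ 2 / 2) <= g' ^+ 2 ->
  beta * g' <= delta * (beta * g) + 2 * a * f ->
  3 * q * e <= 2 * d.
Proof.
move=> a0 b0 de0 r1 q0 qr s0 sE ww w12 u0 d0 e0 g'0 h3 h4 rd fed fwu hdec gd hg' hgr.
have r0 : 0 < r by lra.
(* The decrease gives [beta e^2 <= beta d^2 + 2 a f]. After multiplication by [r], the first term is
   at most [beta] and the second at most [2 (beta / 16) (3 / 2)], an excess of 3/16. *)
have re : r * e ^+ 2 <= 19 / 16.
  have : beta * (r * e ^+ 2) <= beta * (19 / 16).
    have : beta * e ^+ 2 <= beta * d ^+ 2 + 2 * a * (w * u).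
      have : a * f <= a * (w * u) by rewrite ler_wpM2l.
      by lra.
    move=> /(ler_wpM2l (ltW r0)) h.
    have h' : r * (a * u) * w <= beta / 16 * (3 / 2).
      have rau : 0 <= r * (a * u) by rewrite !mulr_ge0// ltW.
      by apply: ler_pM => //; lra.
    have : beta * (r * d ^+ 2) <= beta * 1 by rewrite ler_wpM2l// ltW.
    by lra.
  by rewrite ler_pM2l.
(* The factor 9/16 absorbs the excess 3/16 for every [r >= 1]; its root is the 3/4 in the next
   bound. *)
have hs : 9 / 16 * s ^+ 2 <= 1 - e ^+ 2 / 2.
  rewrite sE; have : r * (9 / 16 * (1 - 1 / (2 * r))) <= r * (1 - e ^+ 2 / 2).
    have -> : r * (9 / 16 * (1 - 1 / (2 * r))) = 9 / 16 * r - 9 / 32.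
      by field; lra.
    by lra.
  by rewrite ler_pM2l.
have hse : 3 / 4 * s * e <= w * g'.
  apply: ler_sqr_nneg; first by rewrite mulr_ge0//; lra.
  rewrite !exprMn ww.
  have : e ^+ 2 / 2 * (9 / 16 * s ^+ 2) <= e ^+ 2 / 2 * (1 - e ^+ 2 / 2).
    by rewrite ler_wpM2l// divr_ge0 ?sqr_ge0.
  by lra.
have hwg : w * g <= d.
  by have := gd; rewrite ler_pdivlMr//; lra.
have hbe : beta * (3 / 4 * s * e) <= delta * beta * d + 2 * w * a * (e + d).
  have h1 : beta * (3 / 4 * s * e) <= beta * (w * g') by rewrite ler_wpM2l// ltW.
  have h2 : w * (beta * g') <= w * (delta * (beta * g) + 2 * a * f).
    by rewrite ler_wpM2l//; lra.
  have h5 : delta * beta * (w * g) <= delta * beta * d.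
    by rewrite ler_wpM2l// mulr_ge0// ltW.
  have h6 : 2 * w * a * f <= 2 * w * a * (e + d).
    by rewrite ler_wpM2l// !mulr_ge0//; lra.
  by lra.
have qa0 : 0 <= q * a by rewrite mulr_ge0.
have wa0 : 0 <= w * a by rewrite mulr_ge0//; lra.
have qdb : 0 <= q * delta * beta by rewrite !mulr_ge0// ltW.
have h3' : 4 * (w * a) + 8 * (q * a) + 2 * (q * delta * beta) <= beta * s.
  have -> : 8 * (q * a) = 4 * w ^+ 2 * (q * a) by rewrite ww; lra.
  by lra.
have bs0 : 0 < beta * s by rewrite mulr_gt0.
(* Collecting the terms in [e] on the left leaves the coefficient [c]. The condition coupling [beta]
   and [delta] is what bounds the remaining coefficient of [d] by [2 c / (3 q)]. *)
set c := 3 / 4 * (beta * s) - 2 * (w * a).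
have c0 : 0 < c by rewrite /c; lra.
have hce : c * e <= (delta * beta + 2 * (w * a)) * d by rewrite /c; lra.
have hqc : 2 * q * (delta * beta + 2 * (w * a)) <= 4 / 3 * c.
  have : q * (w * a) <= 2 * (q * a) by nra.
  by rewrite /c; lra.
rewrite -(ler_pM2l c0).
have : q * (c * e) <= q * ((delta * beta + 2 * (w * a)) * d) by rewrite ler_wpM2l.
have : d * (2 * q * (delta * beta + 2 * (w * a))) <= d * (4 / 3 * c).
  by rewrite ler_wpM2l.
by lra.
Qed.

(** Here [h] is the decrease of the client objective and [l] the trace of the change of Lambda
    against the new projector minus that of the center. The contraction makes [l] small enough to
    cost at most half of the lower bound [c1 / 4 * s^2 * beta * d^2] on [h]. *)
Lemma client_decrease (a beta c1 r s q w d e f g l h : R) :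
  0 <= a -> 0 < beta -> 0 < c1 -> 1 <= r -> 0 <= q -> q ^+ 2 = r ->
  s ^+ 2 = 1 - 1 / (2 * r) -> 4 / 3 <= w <= 3 / 2 ->
  0 <= d -> 0 <= e ->
  4 * (1 + w * q) * a <= beta * c1 * s ^+ 2 * r ->
  r * d ^+ 2 <= 1 -> f <= e + d -> 3 * q * e <= 2 * d ->
  d ^+ 2 / 2 * (1 - d ^+ 2 / 2) <= g ^+ 2 ->
  c1 / 2 * beta * g ^+ 2 <= h -> - (2 * a * f * e) <= l ->
  c1 / 8 * s ^+ 2 * beta * d ^+ 2 <= h + l / 2.
Proof.
move=> a0 b0 c0 r1 q0 qr sE w12 d0 e0 h5 rd fed qe gd hh hl.
have r0 : 0 < r by lra.
have q1 : 1 <= q by apply: ler_sqr_nneg => //; rewrite qr expr1n.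
have hs : s ^+ 2 <= 1 - d ^+ 2 / 2.
  rewrite sE; have : r * (1 - 1 / (2 * r)) <= r * (1 - d ^+ 2 / 2).
    have -> : r * (1 - 1 / (2 * r)) = r - 1 / 2 by field; lra.
    by lra.
  by rewrite ler_pM2l.
have cb0 : 0 <= c1 * beta by rewrite mulr_ge0// ltW.
have hh' : c1 / 4 * s ^+ 2 * beta * d ^+ 2 <= h.
  apply: le_trans hh.
  have : c1 * beta * (d ^+ 2 / 2 * s ^+ 2) <= c1 * beta * g ^+ 2.
    rewrite ler_wpM2l// (le_trans _ gd)// ler_wpM2l// divr_ge0 ?sqr_ge0//.
  by lra.
have hl2 : - (a * ((e + d) * e)) <= l / 2.
  have : a * (e * f) <= a * (e * (e + d)) by rewrite !ler_wpM2l.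
  by lra.
suff : a * ((e + d) * e) <= c1 / 8 * s ^+ 2 * beta * d ^+ 2 by lra.
have e2 : r * e ^+ 2 <= 4 / 9 * d ^+ 2.
  rewrite -qr.
  have : (3 * q * e) ^+ 2 <= (2 * d) ^+ 2.
    by rewrite lerXn2r// nnegrE ?mulr_ge0.
  by rewrite !exprMn; lra.
have e1 : r * (e * d) <= 2 / 3 * q * d ^+ 2.
  have : q * d * (3 * q * e) <= q * d * (2 * d) by rewrite ler_wpM2l// mulr_ge0.
  by rewrite -qr; lra.
rewrite -(ler_pM2l r0).
have h6 : d ^+ 2 * (4 * (1 + w * q) * a) <= d ^+ 2 * (beta * c1 * s ^+ 2 * r).
  by rewrite ler_wpM2l// sqr_ge0.
have h7 : a * (r * e ^+ 2 + r * (e * d)) <= a * (4 / 9 * d ^+ 2 + 2 / 3 * q * d ^+ 2).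
  by rewrite ler_wpM2l// lerD.
have ad0 : 0 <= a * d ^+ 2 by rewrite mulr_ge0// sqr_ge0.
(* The lower bound on [beta] provides [(1 + w q) / 2] times [a d^2]; it covers [4 / 9 + 2 q / 3]
   because [w >= 4 / 3]. *)
have : 2 / 3 * (q * (a * d ^+ 2)) <= w / 2 * (q * (a * d ^+ 2)).
  by rewrite ler_wpM2r ?mulr_ge0//; lra.
by lra.
Qed.

End Scalars.

(** * Client update *)

Section ClientStep.
Variables (R : realType) (n p : nat).

Lemma dist_projE (X Y : 'M[R]_(n, p)) :
  dist_proj X Y = nF (orthproj X - orthproj Y).
Proof. by []. Qed.

Lemma dist_proj_ge0 (X Y : 'M[R]_(n, p)) : 0 <= dist_proj X Y.
Proof. exact: frobenius_norm_ge0. Qed.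

Lemma dist_proj_triangle (Y X Z : 'M[R]_(n, p)) :
  dist_proj X Z <= dist_proj X Y + dist_proj Y Z.
Proof. by rewrite !dist_projE (le_trans _ (frobenius_normD _ _))// addrA subrK. Qed.

Lemma dist_projC (X Y : 'M[R]_(n, p)) : dist_proj X Y = dist_proj Y X.
Proof. exact: frobenius_normC. Qed.

Lemma dist_proj_sqr (X Y : 'M[R]_(n, p)) : stiefel X -> stiefel Y ->
  dist_proj X Y ^+ 2 = 2 * p%:R - 2 * \tr (orthproj X *m orthproj Y).
Proof.
move=> hX hY; rewrite projector_dist_sqr; try exact: orthproj_projector.
by rewrite !mxtrace_orthproj//; ring.
Qed.

Lemma dist_proj_le (X Y : 'M[R]_(n, p)) : stiefel X -> stiefel Y ->
  dist_proj X Y <= Num.sqrt 2 * Num.sqrt p%:R.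
Proof.
move=> hX hY; apply: ler_sqr_nneg; first by rewrite mulr_ge0 ?sqrtr_ge0.
rewrite exprMn (@sqr_sqrtr _ 2)// (@sqr_sqrtr _ p%:R)// -(mxtrace_orthproj hY).
by apply: projector_dist_le; rewrite ?mxtrace_orthproj//; exact: orthproj_projector.
Qed.

Lemma dist_proj_residual_bounds (X Y : 'M[R]_(n, p)) : stiefel X -> stiefel Y ->
  dist_proj X Y ^+ 2 / 2 * (1 - dist_proj X Y ^+ 2 / 2)
    <= nF (orthproj_perp X *m orthproj Y *m X) ^+ 2 <= dist_proj X Y ^+ 2 / 2.
Proof.
move=> hX hY; rewrite -frobenius_norm_mul_stiefel//.
by apply: projector_residual_bounds; rewrite ?mxtrace_orthproj//; exact: orthproj_projector.
Qed.

Lemma local_objectiveE (H : 'M[R]_n) (X : 'M[R]_(n, p)) :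
  local_objective H X = - (2^-1 * \tr (H *m orthproj X)).
Proof. by rewrite /local_objective -mulmxA mxtrace_mulC -mulmxA. Qed.

(** The block-diagonal matrix [A A^T + Lambda] has no tangential component at [X], so only the
    penalty survives. *)
Lemma faps_H_projected m (A : 'M[R]_(n, m)) (beta : R) (X Z : 'M[R]_(n, p)) :
  stiefel X -> orthproj_perp X *m faps_H A beta X Z *m X =
    beta *: (orthproj_perp X *m orthproj Z *m X).
Proof.
move=> hX; rewrite /faps_H faps_LambdaE mulmxDr mulmxDl -scalemxAr -scalemxAl.
suff -> : orthproj_perp X *m (A *m A^T + offdiag (orthproj X) (A *m A^T)) *m X = 0.
  by rewrite add0r.
apply: frobenius_norm_eq0; rewrite -frobenius_norm_mul_stiefel//.
by rewrite projectorC_addr_offdiag_mul ?frobenius_norm0//; exact: orthproj_projector.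
Qed.

Lemma frobenius_norm_gram m (A : 'M[R]_(n, m)) : nF (A *m A^T) <= nF A ^+ 2.
Proof. by rewrite expr2 -{2}(frobenius_norm_tr A) frobenius_normM. Qed.

Lemma tr_gram m (A : 'M[R]_(n, m)) : (A *m A^T)^T = A *m A^T.
Proof. by rewrite trmx_mul trmxK. Qed.

Lemma frobenius_norm_faps_Lambda m (A : 'M[R]_(n, m)) (X : 'M[R]_(n, p)) :
  stiefel X -> nF (faps_Lambda A X) <= nF A ^+ 2.
Proof.
move=> hX; rewrite faps_LambdaE (le_trans _ (frobenius_norm_gram A))//.
exact/frobenius_norm_offdiag/orthproj_projector.
Qed.

Lemma tr_faps_Lambda m (A : 'M[R]_(n, m)) (X : 'M[R]_(n, p)) :
  stiefel X -> (faps_Lambda A X)^T = faps_Lambda A X.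
Proof.
by move=> hX; rewrite faps_LambdaE tr_offdiag ?tr_gram//; exact: orthproj_projector.
Qed.

Lemma faps_Lambda_lipschitz m (A : 'M[R]_(n, m)) (X Y : 'M[R]_(n, p)) :
  stiefel X -> stiefel Y ->
  nF (faps_Lambda A X - faps_Lambda A Y) <= 2 * nF A ^+ 2 * dist_proj X Y.
Proof.
move=> hX hY; rewrite !faps_LambdaE.
apply: (le_trans (offdiag_lipschitz _ (orthproj_projector hX) (orthproj_projector hY))).
by rewrite ler_wpM2r ?frobenius_norm_ge0// ler_wpM2l// frobenius_norm_gram.
Qed.

(* Augmented Lagrangian of the client's constraint X X^T = Z Z^T. *)
Definition faps_merit m (A : 'M[R]_(n, m)) (beta : R) (X Z : 'M[R]_(n, p)) : R :=
  - (2^-1 * \tr (A *m A^T *m orthproj X))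
  - 2^-1 * \tr (faps_Lambda A X *m (orthproj X - orthproj Z))
  + beta / 4 * dist_proj X Z ^+ 2.

Lemma mxtrace_mul_le (M N : 'M[R]_n) : M^T = M -> `|\tr (M *m N)| <= nF M * nF N.
Proof. by move=> {1}<-; exact: frobenius_cauchy_schwarz_norm. Qed.

(** Gives the potential a lower bound along the iterates. The penalty is nonnegative, and
    Cauchy-Schwarz bounds the two traces, with total factor [1 / 2 + sqrt 2 / 2 <= 2]. *)
Lemma faps_merit_ge m (A : 'M[R]_(n, m)) (beta : R) (X Z : 'M[R]_(n, p)) :
  0 < beta -> stiefel X -> stiefel Z ->
  - (2 * nF A ^+ 2 * Num.sqrt p%:R) <= faps_merit A beta X Z.
Proof.
move=> b0 hX hZ; rewrite /faps_merit.
have p0 : 0 <= (Num.sqrt p%:R : R) by exact: sqrtr_ge0.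
have h1 : \tr (A *m A^T *m orthproj X) <= nF A ^+ 2 * Num.sqrt p%:R.
  apply: (le_trans (ler_norm _)); apply: (le_trans (mxtrace_mul_le _ (tr_gram A))).
  apply: ler_pM; rewrite ?frobenius_norm_ge0 ?frobenius_norm_gram//.
  apply: ler_sqr_nneg => //; rewrite (@sqr_sqrtr _ p%:R)//.
  by rewrite frobenius_norm_projector ?mxtrace_orthproj//; exact: orthproj_projector.
have h2 : \tr (faps_Lambda A X *m (orthproj X - orthproj Z)) <=
    nF A ^+ 2 * (Num.sqrt 2 * Num.sqrt p%:R).
  apply: (le_trans (ler_norm _)).
  apply: (le_trans (mxtrace_mul_le _ (tr_faps_Lambda A hX))).
  by apply: ler_pM; rewrite ?frobenius_norm_ge0 ?frobenius_norm_faps_Lambda// dist_proj_le.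
have /andP[_ w2] := sqrt2_bounds R.
have : nF A ^+ 2 * Num.sqrt p%:R * Num.sqrt 2 <= nF A ^+ 2 * Num.sqrt p%:R * (3 / 2).
  by rewrite ler_wpM2l// mulr_ge0// sqr_ge0.
have : 0 <= beta * dist_proj X Z ^+ 2 by rewrite mulr_ge0 ?sqr_ge0// ltW.
have : 0 <= nF A ^+ 2 * Num.sqrt p%:R by rewrite mulr_ge0// sqr_ge0.
by lra.
Qed.

(** The drop of the merit equals the drop of the client objective plus half the trace of
    [Lambda(X') - Lambda(X)] against the difference of the projectors of [X'] and [Z]. The
    contraction is proved first because it controls this trace. *)
Lemma faps_client_progress m (A : 'M[R]_(n, m)) (a beta c1 c1' delta r s : R)
    (X Z X' : 'M[R]_(n, p)) :
  nF A ^+ 2 <= a -> 0 < beta -> 0 < c1 -> 0 < c1' -> 0 <= delta -> 1 <= r ->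
  0 < s -> s ^+ 2 = 1 - 1 / (2 * r) ->
  c1' * a <= beta ->
  4 * Num.sqrt 2 * (1 + Num.sqrt (2 * r)) * a <= beta * (s - 2 * Num.sqrt r * delta) ->
  16 * r * Num.sqrt p%:R * a <= beta ->
  4 * (1 + Num.sqrt (2 * r)) * a <= beta * c1 * s ^+ 2 * r ->
  stiefel X -> stiefel Z -> r * dist_proj X Z ^+ 2 <= 1 ->
  faps_client_step A beta c1 c1' delta X Z X' ->
  3 * Num.sqrt r * dist_proj X' Z <= 2 * dist_proj X Z /\
  c1 / 8 * s ^+ 2 * beta * dist_proj X Z ^+ 2 <=
    faps_merit A beta X Z - faps_merit A beta X' Z.
Proof.
move=> Aa b0 c0 c0' de0 r1 s0 sE h1 h3 h4 h5 hX hZ rd [hX' hdec hgrad].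
have r0 : 0 <= r by lra.
have a0 : 0 <= a by rewrite (le_trans _ Aa)// sqr_ge0.
have q0 : 0 <= Num.sqrt r by exact: sqrtr_ge0.
have qr : Num.sqrt r ^+ 2 = r by rewrite sqr_sqrtr.
have w12 := sqrt2_bounds R.
have w0 : 0 < (Num.sqrt 2 : R) by rewrite sqrtr_gt0.
have ww : (Num.sqrt 2 : R) ^+ 2 = 2 by rewrite sqr_sqrtr.
rewrite (_ : Num.sqrt (2 * r) = Num.sqrt 2 * Num.sqrt r) in h3 h5; last first.
  by rewrite sqrtrM.
have /andP[glo ghi] := dist_proj_residual_bounds hX hZ.
have /andP[g'lo _] := dist_proj_residual_bounds hX' hZ.
set g := nF (orthproj_perp X *m orthproj Z *m X) in glo ghi.
set g' := nF (orthproj_perp X' *m orthproj Z *m X') in g'lo.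
have g0 : 0 <= g := frobenius_norm_ge0 _.
rewrite faps_H_projected// frobenius_normZ (ger0_norm (ltW b0)) -/g in hdec hgrad.
have fed : dist_proj X' X <= dist_proj X' Z + dist_proj X Z.
  by rewrite (dist_projC X) dist_proj_triangle.
have fwu := dist_proj_le hX' hX.
set T := A *m A^T + faps_Lambda A X.
have sT : T^T = T by rewrite /T linearD/= tr_gram tr_faps_Lambda.
have hdecE : local_objective (faps_H A beta X Z) X
    - local_objective (faps_H A beta X Z) X' =
    \tr (T *m (orthproj X' - orthproj X)) / 2
    + beta / 4 * (dist_proj X Z ^+ 2 - dist_proj X' Z ^+ 2).
  rewrite !local_objectiveE /faps_H -/T !dist_proj_sqr// !mulmxDl mulmxBr.
  rewrite -!scalemxAl !mxtraceD !mxtraceZ linearB/=.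
  rewrite (mxtrace_mulC (orthproj X)) (mxtrace_mulC (orthproj X')).
  by lra.
have hT : \tr (T *m (orthproj X' - orthproj X)) <= a * dist_proj X' X.
  apply: (le_trans (ler_norm _)); apply: (le_trans (mxtrace_mul_le _ sT)).
  rewrite ler_wpM2r ?frobenius_norm_ge0// (le_trans _ Aa)//.
  rewrite (le_trans _ (frobenius_norm_gram A))// /T faps_LambdaE.
  exact/frobenius_norm_addr_offdiag/orthproj_projector.
(* The first bound on [beta] makes the denominator in the sufficient decrease at most [2 * beta],
   while the squared gradient is [beta^2 g^2]. *)
have hgain : c1 / 2 * beta * g ^+ 2 <= local_objective (faps_H A beta X Z) X
    - local_objective (faps_H A beta X Z) X'.
  apply: le_trans hdec.
  have /andP[sp0 spF] := spectral_norm_le A.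
  have sp : c1' * spectral_norm A ^+ 2 <= beta.
    apply: le_trans h1; rewrite ler_wpM2l ?(ltW c0')// (le_trans _ Aa)//.
    by rewrite lerXn2r// nnegrE// frobenius_norm_ge0.
  have den0 : 0 < c1' * spectral_norm A ^+ 2 + beta.
    by rewrite ltr_wpDl// mulr_ge0 ?sqr_ge0// ltW.
  have -> : c1 / 2 * beta * g ^+ 2 = c1 / (2 * beta) * (beta * g) ^+ 2.
    by field; lra.
  rewrite ler_wpM2r ?sqr_ge0// ler_wpM2l ?(ltW c0)// lef_pV2 ?posrE//; last first.
    by rewrite mulr_gt0.
  by lra.
have hgain0 : 0 <= c1 / 2 * beta * g ^+ 2.
  by rewrite mulr_ge0 ?sqr_ge0// mulr_ge0 ?divr_ge0 ?(ltW c0) ?(ltW b0).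
(* The penalty gradient at [X'] is the full gradient, bounded by the inexactness criterion, minus
   the block of [T], which is of first order in the step. *)
have hg' : beta * g' <= delta * (beta * g) + 2 * a * dist_proj X' X.
  have : beta *: (orthproj_perp X' *m orthproj Z *m X') =
      orthproj_perp X' *m faps_H A beta X Z *m X' - orthproj_perp X' *m T *m X'.
    by rewrite -mulmxBl -mulmxBr /faps_H -/T (addrC T) addrK -scalemxAr -scalemxAl.
  move=> /(congr1 (@frobenius_norm R n p)); rewrite frobenius_normZ (ger0_norm (ltW b0)) => ->.
  apply: (le_trans (frobenius_normB _ _)); rewrite lerD//.
  rewrite -frobenius_norm_mul_stiefel// /T faps_LambdaE.
  apply: (le_trans (frobenius_norm_mul_addr_offdiag _ (orthproj_projector hX)
    (orthproj_projector hX'))).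
  rewrite ler_wpM2r ?frobenius_norm_ge0// ler_wpM2l// (le_trans _ Aa)//.
  exact: frobenius_norm_gram.
have gd : g <= dist_proj X Z / Num.sqrt 2.
  apply: ler_sqr_nneg; first by rewrite divr_ge0 ?dist_proj_ge0// ltW.
  by rewrite exprMn exprVn ww.
have key : 3 * Num.sqrt r * dist_proj X' Z <= 2 * dist_proj X Z.
  apply: (client_contraction (w := Num.sqrt 2) (u := Num.sqrt p%:R) a0 b0 de0 r1
    q0 qr s0 sE _ _ _ _ _ _ h3 h4 rd fed fwu _ gd g'lo hg') => //;
    rewrite ?dist_proj_ge0 ?frobenius_norm_ge0 ?sqrtr_ge0//.
  by lra.
split=> //.
have hL : - (2 * a * dist_proj X' X * dist_proj X' Z) <=
    \tr ((faps_Lambda A X' - faps_Lambda A X) *m (orthproj X' - orthproj Z)).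
  rewrite lerNl; apply: (le_trans (ler_norm _)); rewrite normrN.
  have sL : (faps_Lambda A X' - faps_Lambda A X)^T = faps_Lambda A X' - faps_Lambda A X.
    by rewrite linearB/= !tr_faps_Lambda.
  apply: (le_trans (mxtrace_mul_le _ sL)).
  rewrite ler_wpM2r ?frobenius_norm_ge0//.
  apply: (le_trans (faps_Lambda_lipschitz _ hX' hX)).
  by rewrite ler_wpM2r ?frobenius_norm_ge0// ler_wpM2l.
have := client_decrease a0 b0 c0 r1 q0 qr sE w12 (dist_proj_ge0 _ _)
  (dist_proj_ge0 _ _) h5 rd fed key glo hgain hL.
move=> /le_trans; apply.
rewrite hdecE /faps_merit /T mulmxDl mulmxBl !mulmxBr !mxtraceD !linearB/=.
by lra.
Qed.

End ClientStep.

(** * Center update *)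

Section Sums.
Variable R : realType.

(** Cauchy-Schwarz against the all-ones vector. *)
Lemma sqr_sum_le d (x : 'I_d -> R) :
  (\sum_i x i) ^+ 2 <= d%:R * \sum_i x i ^+ 2.
Proof.
have /(congr1 (fun y => y ^+ 2)) : \sum_i x i =
    \tr ((const_mx 1 : 'cV[R]_d)^T *m (\col_i x i)).
  by rewrite /mxtrace big_ord1 !mxE; apply: eq_bigr => i _; rewrite !mxE mul1r.
move=> ->; rewrite -(real_normK (num_real _)).
apply: (@le_trans _ _ ((nF (const_mx 1 : 'cV[R]_d) * nF (\col_i x i)) ^+ 2)).
  rewrite lerXn2r ?nnegrE ?mulr_ge0 ?frobenius_norm_ge0//.
  exact: frobenius_cauchy_schwarz_norm.
rewrite exprMn !frobenius_normE.
rewrite (eq_bigr (fun=> 1)) ?sumr_const ?card_ord; last first.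
  by move=> i _; rewrite big_ord1 mxE expr1n.
rewrite (eq_bigr (fun i => x i ^+ 2))// => i _.
by rewrite big_ord1 mxE.
Qed.

Lemma ler_sum_term (I : finType) (x : I -> R) (i : I) :
  (forall j, 0 <= x j) -> x i <= \sum_j x j.
Proof. by move=> x0; rewrite (bigD1 i)//= lerDl sumr_ge0. Qed.

End Sums.

Lemma frobenius_norm_mxrow (R : realType) n d (m : 'I_d -> nat)
    (A : forall i, 'M[R]_(n, m i)) :
  nF (\mxrow_i A i) ^+ 2 = \sum_i nF (A i) ^+ 2.
Proof.
rewrite -frobenius_norm_tr frobenius_norm_sqr trmxK tr_mxrow mul_mxrow_mxcol.
rewrite raddf_sum; apply: eq_bigr => i _.
by rewrite -frobenius_norm_tr frobenius_norm_sqr trmxK.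
Qed.

Section CenterStep.
Variables (R : realType) (n p d : nat) (m : 'I_d -> nat).
Variables (A : forall i, 'M[R]_(n, m i)) (beta : 'I_d -> R) (a r rho : R).
Variables (X : 'I_d -> 'M[R]_(n, p)) (Z Z' : 'M[R]_(n, p)).
Hypotheses (hX : forall i, stiefel (X i)) (hZ : stiefel Z).
Hypothesis hZ' : orth (\sum_i faps_Q (A i) (beta i) (X i) *m Z) Z'.
Hypothesis beta_gt0 : forall i, 0 < beta i.
Hypothesis sum_le_a : \sum_i nF (A i) ^+ 2 <= a.
Hypothesis a_small : forall i, 13 * a <= beta i.

Let a_ge0 : 0 <= a.
Proof. by rewrite (le_trans _ sum_le_a)// sumr_ge0// => i _; exact: sqr_ge0. Qed.

Let Ai_le i : nF (A i) ^+ 2 <= a.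
Proof.
apply: le_trans sum_le_a.
by apply: (ler_sum_term (x := fun i => nF (A i) ^+ 2)) => j; exact: sqr_ge0.
Qed.

Let D := orthproj Z' - orthproj Z.
Let Q := \sum_i faps_Q (A i) (beta i) (X i).

Lemma center_stiefel : stiefel Z'.
Proof. by case: hZ'. Qed.

Let hPX i := orthproj_projector (hX i).
Let hPZ := orthproj_projector hZ.
Let hPZ' := orthproj_projector center_stiefel.

Lemma center_invariance : Q *m orthproj Z = orthproj Z' *m Q *m orthproj Z.
Proof.
(* The row-space inclusion of the transposes yields [Q Z = Z' M^T], which the projector of [Z']
   fixes. *)
have [_ /andP[_ /submxP[M hM]]] := hZ'.
have QZ : Q *m Z = Z' *m M^T by rewrite /Q mulmx_suml -[LHS]trmxK hM trmx_mul trmxK.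
rewrite /orthproj !mulmxA -(mulmxA _ Q Z) QZ mulmxA -(mulmxA Z' Z'^T Z').
by rewrite (center_stiefel : Z'^T *m Z' = _) mulmx1.
Qed.

Lemma tr_center_matrix : Q^T = Q.
Proof.
rewrite /Q raddf_sum; apply: eq_bigr => i _.
rewrite /faps_Q /= linearB/= linearZ/=.
by rewrite (hPX i).1 tr_faps_Lambda.
Qed.

Lemma mxtrace_center_mul (M : 'M[R]_n) :
  \tr (Q *m M) = \sum_i \tr (faps_Q (A i) (beta i) (X i) *m M).
Proof. by rewrite /Q mulmx_suml raddf_sum. Qed.

(** Distances with square at most 4/9 give each client a gain [7 / 18 * beta]; Lambda costs at most
    [a <= beta / 13], and [7 / 18 - 1 / 13] exceeds 1/4. *)
Lemma center_gain : (forall i, dist_proj (X i) Z ^+ 2 <= 4 / 9) ->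
  (\sum_i beta i) / 4 * dist_proj Z' Z ^+ 2 <= \tr (Q *m D).
Proof.
move=> hd.
rewrite (orthogonal_iteration_gain tr_center_matrix hPZ hPZ' center_invariance).
rewrite mxtrace_center_mul !mulr_suml; apply: ler_sum => i _ /=.
rewrite /faps_Q mulmxBl -scalemxAl linearB linearZ/=.
have := projector_gain_lower_bound (hPX i) hPZ hPZ'.
rewrite !mxtrace_orthproj//; [|exact: center_stiefel].
move=> /(_ erefl erefl); rewrite -!dist_projE -/D => h1.
have h2 : \tr (faps_Lambda (A i) (X i) *m (D *m D)) <= a * dist_proj Z' Z ^+ 2.
  apply: (le_trans (ler_norm _)).
  apply: (le_trans (mxtrace_mul_le _ (tr_faps_Lambda _ (hX i)))).
  apply: ler_pM; rewrite ?frobenius_norm_ge0//.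
    exact: le_trans (frobenius_norm_faps_Lambda _ (hX i)) (Ai_le i).
  by rewrite expr2; exact: frobenius_normM.
have h3 : beta i * (7 / 18 * dist_proj Z' Z ^+ 2) <=
    beta i * \tr (orthproj (X i) *m (D *m D)).
  rewrite ler_wpM2l ?(ltW (beta_gt0 i))// (le_trans _ h1)//.
  have : 7 / 9 * dist_proj Z' Z ^+ 2
      <= (1 - dist_proj (X i) Z ^+ 2 / 2) * dist_proj Z' Z ^+ 2.
    by rewrite ler_wpM2r ?sqr_ge0//; have := hd i; lra.
  by lra.
have h4 : 13 * a * dist_proj Z' Z ^+ 2 <= beta i * dist_proj Z' Z ^+ 2.
  by rewrite ler_wpM2r ?sqr_ge0.
have h5 : 0 <= beta i * dist_proj Z' Z ^+ 2 by rewrite mulr_ge0 ?sqr_ge0 ?ltW.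
by rewrite -/D; lra.
Qed.

(** As a function of the projector of [Z], the sum of the merits is affine with linear part
    [- tr (Q _) / 2], so the identity is exact. *)
Lemma center_merit : \sum_i faps_merit (A i) (beta i) (X i) Z
  - \sum_i faps_merit (A i) (beta i) (X i) Z' = \tr (Q *m D) / 2.
Proof.
rewrite mxtrace_center_mul mulr_suml -sumrB; apply: eq_bigr => i _ /=.
rewrite /faps_merit /faps_Q !dist_proj_sqr//; last exact: center_stiefel.
by rewrite mulmxBl -scalemxAl /D !mulmxBr !raddfB/= !mxtraceZ; lra.
Qed.

(** Up to a constant, the weighted sum is [- 2 tr (Q _) - 2 sum tr (Lambda_i _)] in the projector of
    the center; a nonnegative gain leaves only the Lambda terms to increase it. *)
Lemma center_dist_sum : 0 <= \tr (Q *m D) ->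
  \sum_i beta i * dist_proj (X i) Z' ^+ 2 <=
  \sum_i beta i * dist_proj (X i) Z ^+ 2 + 2 * a * dist_proj Z' Z.
Proof.
move=> hQ.
have e : \sum_i beta i * dist_proj (X i) Z' ^+ 2 -
    \sum_i beta i * dist_proj (X i) Z ^+ 2 =
    - 2 * \tr (Q *m D) - 2 * \sum_i \tr (faps_Lambda (A i) (X i) *m D).
  rewrite mxtrace_center_mul !mulr_sumr -!sumrB; apply: eq_bigr => i _ /=.
  rewrite /faps_Q !dist_proj_sqr//; last exact: center_stiefel.
  by rewrite mulmxBl -scalemxAl /D !mulmxBr !raddfB/= !mxtraceZ; lra.
have : - \sum_i \tr (faps_Lambda (A i) (X i) *m D) <= a * dist_proj Z' Z.
  rewrite -sumrN (@le_trans _ _ (\sum_i nF (A i) ^+ 2 * dist_proj Z' Z))//.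
    apply: ler_sum => i _; apply: (le_trans (ler_norm _)); rewrite normrN.
    apply: (le_trans (mxtrace_mul_le _ (tr_faps_Lambda _ (hX i)))).
    by rewrite ler_wpM2r ?frobenius_norm_ge0// frobenius_norm_faps_Lambda.
  by rewrite -mulr_suml ler_wpM2r ?frobenius_norm_ge0.
by lra.
Qed.

(** One weighted distance is bounded by the whole sum. Times [r], that sum is at most
    [4 / 9 * beta i] before the center step and grows by at most [3 / 16 * beta i]; the total stays
    below [beta i]. *)
Lemma center_feasible : rho * d%:R = r -> 1 <= r -> (forall i j, beta i <= rho * beta j) ->
  (forall i, 16 * r * Num.sqrt p%:R * a <= beta i) ->
  (forall i, 9 * r ^+ 2 * dist_proj (X i) Z ^+ 2 <= 4) ->
  0 <= \tr (Q *m D) ->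
  forall i, r * dist_proj (X i) Z' ^+ 2 <= 1.
Proof.
move=> rd r1 hrho ha he hQ i; have r0 : 0 < r by lra.
rewrite -(ler_pM2l (beta_gt0 i)) mulr1.
have h1 : beta i * dist_proj (X i) Z' ^+ 2 <= \sum_j beta j * dist_proj (X j) Z' ^+ 2.
  apply: (ler_sum_term (x := fun j => beta j * dist_proj (X j) Z' ^+ 2)) => j.
  by rewrite mulr_ge0 ?sqr_ge0 ?ltW.
have h2 := center_dist_sum hQ.
have h3 : 9 * r * \sum_j beta j * dist_proj (X j) Z ^+ 2 <= 4 * beta i.
  rewrite -(ler_pM2l r0).
  (* The factor [d] in [r] is spread over the clients and [rho] pays for replacing [beta j] by
     [beta i]. *)
  have -> : r * (4 * beta i) = \sum_(j < d) rho * beta i * 4.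
    by rewrite sumr_const card_ord -rd -[RHS]mulr_natl; ring.
  rewrite !mulr_sumr; apply: ler_sum => j _.
  have : beta j * (9 * r ^+ 2 * dist_proj (X j) Z ^+ 2) <= rho * beta i * 4.
    apply: ler_pM => //; first exact: ltW.
    by rewrite mulr_ge0 ?sqr_ge0// mulr_ge0 ?sqr_ge0.
  by lra.
have h4 : r * (a * dist_proj Z' Z) <= 3 / 32 * beta i.
  have /andP[_ w2] := sqrt2_bounds R.
  have h : r * a * dist_proj Z' Z <= r * a * (Num.sqrt 2 * Num.sqrt p%:R).
    rewrite ler_wpM2l ?mulr_ge0 ?(ltW r0)//.
    by apply: dist_proj_le => //; exact: center_stiefel.
  have h' : r * a * Num.sqrt p%:R * Num.sqrt 2 <= r * a * Num.sqrt p%:R * (3 / 2).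
    by rewrite ler_wpM2l ?mulr_ge0 ?sqrtr_ge0 ?(ltW r0).
  by have := ha i; lra.
have := ler_wpM2l (ltW r0) h1; have := ler_wpM2l (ltW r0) h2.
have := beta_gt0 i; lra.
Qed.

(** Lets the stationarity residual be read off from [- Lambda], which is part of the center
    matrix. *)
Lemma faps_Lambda_center_projected i :
  orthproj_perp Z *m faps_Lambda (A i) Z *m orthproj Z =
  - (orthproj_perp Z *m (A i *m (A i)^T) *m orthproj Z).
Proof.
have := projectorC_addr_offdiag_mul (A i *m (A i)^T) hPZ.
rewrite -faps_LambdaE mulmxDr mulmxDl => /eqP.
by rewrite addrC addr_eq0 => /eqP.
Qed.

(** Replacing each Lambda at [X i] by Lambda at [Z] turns the off-diagonal block of [Q] into the
    residual, with an error of first order in the client distances. The block itself is of first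
    order in the center displacement. *)
Lemma stationary_residual_le :
  nF (stationary_residual (\mxrow_i A i) Z) <=
  (Num.sqrt p%:R + 1) * (\sum_i beta i) * dist_proj Z' Z
    + 3 * \sum_i beta i * dist_proj (X i) Z.
Proof.
have hC := orth_projectorC hPZ; rewrite -/(orthproj_perp Z) in hC.
have ab i : a <= beta i by have := a_small i; have := a_ge0; lra.
rewrite /stationary_residual -(mulmxA (orthproj_perp Z)) tr_mxrow mul_mxrow_mxcol.
rewrite -frobenius_norm_mul_stiefel//.
have -> : orthproj_perp Z *m (\sum_i A i *m (A i)^T) *m orthproj Z =
    orthproj_perp Z *m Q *m orthproj Z
    - \sum_i (beta i *: (orthproj_perp Z *m (orthproj (X i) - orthproj Z) *m orthproj Z)
      - orthproj_perp Z *m (faps_Lambda (A i) (X i) - faps_Lambda (A i) Z) *m orthproj Z).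
  have hL := faps_Lambda_center_projected.
  have hCP : orthproj_perp Z *m orthproj Z = 0 := projectorC_mul hPZ.
  move: (orthproj_perp Z) hL hCP => C hL hCP.
  rewrite /Q !mulmx_sumr !mulmx_suml -sumrB; apply: eq_bigr => i _.
  rewrite /faps_Q !mulmxBr !mulmxBl hL hCP mul0mx -scalemxAr -scalemxAl.
  by apply/matrixP => k l; rewrite !mxE; ring.
apply: (le_trans (frobenius_normB _ _)); apply: lerD; last first.
  apply: (le_trans (frobenius_norm_sum _)); rewrite mulr_sumr; apply: ler_sum => i _.
  apply: (le_trans (frobenius_normB _ _)).
  have h1 : nF (orthproj_perp Z *m (orthproj (X i) - orthproj Z) *m orthproj Z)
      <= dist_proj (X i) Z.
    apply: (le_trans (frobenius_norm_projectorr _ hPZ)).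
    exact: frobenius_norm_projectorl.
  have h2 : nF (orthproj_perp Z *m (faps_Lambda (A i) (X i) - faps_Lambda (A i) Z)
      *m orthproj Z) <= 2 * a * dist_proj (X i) Z.
    apply: (le_trans (frobenius_norm_projectorr _ hPZ)).
    apply: (le_trans (frobenius_norm_projectorl _ hC)).
    apply: (le_trans (faps_Lambda_lipschitz _ (hX i) hZ)).
    by rewrite ler_wpM2r ?frobenius_norm_ge0// ler_wpM2l.
  rewrite frobenius_normZ (ger0_norm (ltW (beta_gt0 i))).
  have := ler_wpM2l (ltW (beta_gt0 i)) h1.
  have := ler_wpM2r (dist_proj_ge0 (X i) Z) (ab i).
  by lra.
(* Invariance turns [Q P] into [P' Q P], and [1 - P] kills [P Q P], so a factor [D] appears. *)
have -> : orthproj_perp Z *m Q *m orthproj Z = orthproj_perp Z *m (D *m (Q *m orthproj Z)).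
  have -> : D *m (Q *m orthproj Z) = Q *m orthproj Z - orthproj Z *m Q *m orthproj Z.
    by rewrite /D mulmxBl (mulmxA (orthproj Z') Q) -center_invariance (mulmxA (orthproj Z) Q).
  have hCP : orthproj_perp Z *m orthproj Z = 0 := projectorC_mul hPZ.
  move: (orthproj_perp Z) hCP => C hCP.
  rewrite mulmxBr (mulmxA C (orthproj Z *m Q)) (mulmxA C (orthproj Z) Q) hCP.
  by rewrite !mul0mx subr0 (mulmxA C Q).
apply: (le_trans (frobenius_norm_projectorl _ hC)).
apply: (le_trans (frobenius_normM _ _)); rewrite mulrC ler_wpM2r ?frobenius_norm_ge0//.
apply: (le_trans (frobenius_norm_projectorr _ hPZ)).
apply: (le_trans (frobenius_norm_sum _)); rewrite mulr_sumr; apply: ler_sum => i _.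
apply: (le_trans (frobenius_normB _ _)).
rewrite frobenius_normZ (ger0_norm (ltW (beta_gt0 i))) mulrDl mul1r lerD//.
  rewrite mulrC ler_wpM2r ?(ltW (beta_gt0 i))//; apply: ler_sqr_nneg; first exact: sqrtr_ge0.
  by rewrite frobenius_norm_projector// mxtrace_orthproj// sqr_sqrtr.
by rewrite (le_trans (frobenius_norm_faps_Lambda _ (hX i)))// (le_trans (Ai_le i)).
Qed.

End CenterStep.

(** * Matrix sequences *)

Section MatrixTopology.
Variable R : realType.

Lemma vec_mx_continuous m n : continuous (@vec_mx R m n).
Proof.
move=> v s /nbhs_ballP[e e0 es]; apply/nbhs_ballP; exists e => //= N [_ vN].
by apply: es; split=> // i j; rewrite !mxE; exact: vN.
Qed.

(** Compactness of boxes of row vectors is carried over to matrices by the continuous map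
    [vec_mx]. *)
Lemma mx_segment_compact m n (a b : R) :
  compact [set M : 'M[R]_(m, n) | forall i j, M i j \in `[a, b]].
Proof.
have -> : [set M : 'M[R]_(m, n) | forall i j, M i j \in `[a, b]] =
    vec_mx @` [set v : 'rV[R]_(m * n) | forall k, `[a, b]%classic (v ord0 k)].
  apply/seteqP; split=> [M hM|_ [v hv <-] i j]; last by rewrite mxE; exact: hv.
  exists (mxvec M); last exact: mxvecK.
  by move=> k; case/mxvec_indexP: k => i j; rewrite mxvecE; exact: hM.
apply: continuous_compact; last first.
  by apply: (@rV_compact _ _ (fun=> `[a, b]%classic)) => k; exact: segment_compact.
by apply: continuous_subspaceT; exact: vec_mx_continuous.
Qed.

Lemma mulmx_continuous (T : topologicalType) m n q
    (f : T -> 'M[R]_(m, n)) (g : T -> 'M[R]_(n, q)) :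
  (forall i j, continuous (fun x => f x i j)) ->
  (forall i j, continuous (fun x => g x i j)) ->
  forall i j, continuous (fun x => (f x *m g x) i j).
Proof.
move=> hf hg i j x; under eq_fun do rewrite mxE.
apply: (@cvg_big _ _ _ _ _ (@add_continuous _)) => k _.
by apply: cvgM; [exact: hf|exact: hg].
Qed.

(** Each set [|f y - l| <= e] is closed and belongs to the filter, so it contains every cluster
    point; no subsequence has to be extracted. *)
Lemma cluster_cvg_image (T : topologicalType) (F : set_system T) (FF : Filter F)
    (f : T -> R) (x : T) (l : R) :
  continuous f -> f @ F --> l -> cluster F x -> f x = l.
Proof.
move=> cf fl clx; apply/eqP; rewrite -subr_eq0 -normr_le0.
apply/ler_addgt0Pr => e e0; rewrite add0r.
have hC : closed [set y | `|f y - l| <= e].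
  apply: (preimage_closed _ (@closed_le R e)) => y _.
  by apply: cvg_norm; apply: cvgB; [exact: cf|exact: cvg_cst].
have FC : F [set y | `|f y - l| <= e].
  move/cvgrPdist_le: fl => /(_ e e0); apply: filterS => y /=.
  by rewrite distrC.
by move: clx; rewrite clusterE => /(_ _ FC)/hC.
Qed.

Lemma stiefel_entry_le n p (Z : 'M[R]_(n, p)) i j : stiefel Z -> `|Z i j| <= 1.
Proof.
move=> hZ; rewrite -(@ler_sqr _ `|_|) ?nnegrE// real_normK ?num_real// expr1n.
have : (Z^T *m Z) j j = 1 by rewrite (hZ : _ = 1%:M) mxE eqxx.
rewrite mxE (bigD1 i)//= mxE -expr2 => <-.
by rewrite lerDl sumr_ge0// => k _; rewrite mxE -expr2 sqr_ge0.
Qed.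

(** Orthonormal columns keep all entries in the compact box [[-1, 1]]. *)
Lemma stiefel_cluster_nonempty n p (Z : nat -> 'M[R]_(n, p)) :
  (forall k, stiefel (Z k)) -> cluster (Z k @[k --> \oo]) !=set0.
Proof.
move=> hZ; have [|x [_ hx]] := @mx_segment_compact n p (-1) 1 (Z k @[k --> \oo]) _.
  by exists 0%N => // k _ i j /=; rewrite in_itv/= -ler_norml stiefel_entry_le.
by exists x.
Qed.

Lemma trmx_mul_entry_continuous n p i j :
  continuous (fun Z : 'M[R]_(n, p) => (Z^T *m Z) i j).
Proof.
apply: mulmx_continuous => k l; last exact: coord_continuous.
by under eq_fun do rewrite mxE; exact: coord_continuous.
Qed.

Lemma stationary_residual_entry_continuous n m p (A : 'M[R]_(n, m)) i j :
  continuous (fun Z : 'M[R]_(n, p) => stationary_residual A Z i j).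
Proof.
rewrite /stationary_residual /orthproj_perp.
apply: mulmx_continuous i j => i j; last exact: coord_continuous.
apply: mulmx_continuous i j => i j; last exact: cst_continuous.
apply: mulmx_continuous i j => i j; last exact: cst_continuous.
have cXXT : continuous (fun Z : 'M[R]_(n, p) => (Z *m Z^T) i j).
  apply: mulmx_continuous => k l; first exact: coord_continuous.
  by under eq_fun do rewrite mxE; exact: coord_continuous.
under eq_fun do rewrite mxE [X in _ + X]mxE.
by move=> Z; apply: (continuousB (@cst_continuous _ _ _ Z)); exact: cXXT.
Qed.

(** Both requirements are entrywise equations between continuous functions. The residual entries are
    squared so that the squared norm dominates them. *)
Lemma cluster_stationary n m p (A : 'M[R]_(n, m)) (Z : nat -> 'M[R]_(n, p))
    (Zs : 'M[R]_(n, p)) :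
  (forall k, stiefel (Z k)) ->
  nF (stationary_residual A (Z k)) ^+ 2 @[k --> \oo] --> 0 ->
  cluster (Z k @[k --> \oo]) Zs -> first_order_stationary A Zs.
Proof.
move=> hZ hres hcl; split.
  apply/matrixP => i j.
  pose f (Y : 'M[R]_(n, p)) := (Y^T *m Y) i j.
  apply: (@cluster_cvg_image _ (Z k @[k --> \oo]) _ f Zs _ _ _ hcl).
    exact: trmx_mul_entry_continuous.
  suff : f (Z k) @[k --> \oo] --> (1%:M : 'M[R]_p) i j by [].
  by apply: cvg_near_cst; apply: nearW => k; rewrite /f (hZ k : _ = 1%:M).
apply/matrixP => i j; rewrite [RHS]mxE; apply/eqP; rewrite -sqrf_eq0; apply/eqP.
pose f (Y : 'M[R]_(n, p)) := stationary_residual A Y i j ^+ 2.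
apply: (@cluster_cvg_image _ (Z k @[k --> \oo]) _ f Zs _ _ _ hcl).
  have cR := @stationary_residual_entry_continuous n m p A i j.
  by move=> Y; apply: (continuousM (cR Y) (cR Y)).
suff : f (Z k) @[k --> \oo] --> 0 by [].
apply: (squeeze_cvgr _ (cvg_cst 0) hres); apply: nearW => k.
rewrite /f sqr_ge0/= frobenius_normE (bigD1 i)//= (bigD1 j)//= -addrA lerDl.
by rewrite addr_ge0 ?sumr_ge0// => l _; rewrite ?sumr_ge0// ?sqr_ge0// => ? _; rewrite sqr_ge0.
Qed.

Lemma bounded_series_cvg0 (u : nat -> R) (M : R) : (forall k, 0 <= u k) ->
  (forall N, \sum_(k < N) u k <= M) -> u @ \oo --> 0.
Proof.
move=> u0 uM; apply: cvg_series_cvg_0; apply: nondecreasing_is_cvgn.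
  by apply: nondecreasing_series => k _ _; exact: u0.
by exists M => _ [N _ <-]; rewrite /series/= big_mkord.
Qed.

(** Since [0 < N], the default value [u 0] is itself one of the terms, so the operator is the true
    minimum. *)
Lemma bigmin_le_average (u : nat -> R) (N : nat) : (0 < N)%N ->
  \big[Num.min/u 0%N]_(k < N) u k <= (\sum_(k < N) u k) / N%:R.
Proof.
move=> N0; rewrite ler_pdivlMr ?ltr0n//.
rewrite (_ : _ * N%:R = \sum_(k < N) \big[Num.min/u 0%N]_(l < N) u l).
  by apply: ler_sum => k _; exact: (bigmin_le _ k (fun l : 'I_N => u l)).
by rewrite sumr_const card_ord mulr_natr.
Qed.

End MatrixTopology.

(** * Convergence *)

Section PenaltyParameters.
Variables (R : realType) (p d : nat) (c1 c1' a : R) (delta beta : 'I_d -> R).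
Hypotheses (d_gt0 : (0 < d)%N) (c1_gt0 : 0 < c1) (a_ge0 : 0 <= a).
Hypotheses (beta_gt0 : forall i, 0 < beta i) (delta_ge0 : forall i, 0 <= delta i).

Let r := penalty_ratio beta * d%:R.
Let s := sigma_lower beta.

Lemma penalty_ratio_ge i j : beta i <= penalty_ratio beta * beta j.
Proof.
rewrite -ler_pdivrMr// /penalty_ratio.
apply: (le_trans _ (le_bigmax _ _ i)).
exact: (le_bigmax _ (fun j => beta i / beta j)).
Qed.

Lemma penalty_ratio_ge1 : 1 <= penalty_ratio beta.
Proof.
have := penalty_ratio_ge (Ordinal d_gt0) (Ordinal d_gt0).
by rewrite -{1}[beta _]mul1r ler_pM2r.
Qed.

Lemma penalty_ratio_d_ge1 : 1 <= r.
Proof. by rewrite -[1]mulr1 ler_pM ?penalty_ratio_ge1 ?ler1n. Qed.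

Lemma sigma_lower_sqr : s ^+ 2 = 1 - 1 / (2 * r).
Proof.
rewrite sqr_sqrtr -?mulrA// subr_ge0 ler_pdivrMr ?mul1r.
  by have := penalty_ratio_d_ge1; rewrite /r; lra.
by have := penalty_ratio_d_ge1; rewrite /r; lra.
Qed.

Lemma sigma_lower_gt0 : 0 < s.
Proof.
have r1 := penalty_ratio_d_ge1.
rewrite lt0r sqrtr_ge0 andbT -sqrf_eq0 -/s sigma_lower_sqr gt_eqF//.
rewrite subr_gt0 ltr_pdivrMr; lra.
Qed.

Lemma sigma_lower_le1 : s <= 1.
Proof.
apply: ler_sqr_nneg => //; rewrite sigma_lower_sqr expr1n gerBl divr_ge0//.
by have := penalty_ratio_d_ge1; lra.
Qed.

Lemma ler_mul_of_div (x y z b : R) : 0 < y -> x / y * z <= b -> x * z <= b * y.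
Proof. by move=> y0; rewrite mulrAC ler_pdivrMr. Qed.

(** Each bound is one entry of the maximum [omega] with its denominator cleared; the smallness of
    [delta i] makes the denominator containing it positive. *)
Lemma omega_bounds i : delta i < s / (2 * Num.sqrt r) ->
  omega p c1 c1' beta (delta i) * a <= beta i ->
  [/\ c1' * a <= beta i,
      4 * Num.sqrt 2 * (1 + Num.sqrt (2 * r)) * a
        <= beta i * (s - 2 * Num.sqrt r * delta i),
      16 * r * Num.sqrt p%:R * a <= beta i &
      4 * (1 + Num.sqrt (2 * r)) * a <= beta i * c1 * s ^+ 2 * r].
Proof.
have r1 := penalty_ratio_d_ge1; have r0 : 0 < r by lra.
have sq0 : 0 < Num.sqrt r by rewrite sqrtr_gt0.
rewrite ltr_pdivlMr ?mulr_gt0// => hdel hom.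
have hle x : x <= omega p c1 c1' beta (delta i) -> x * a <= beta i.
  by move=> hx; rewrite (le_trans _ hom)// ler_wpM2r.
split.
- by apply: hle; rewrite /omega le_max lexx.
- apply: ler_mul_of_div; first by lra.
  by apply: hle; rewrite /omega !le_max lexx !orbT.
- by apply: hle; rewrite /omega !le_max lexx !orbT.
- rewrite (_ : beta i * c1 * s ^+ 2 * r = beta i * (c1 * s ^+ 2 * r)); last by ring.
  apply: ler_mul_of_div.
    by rewrite mulr_gt0// mulr_gt0// exprn_gt0// sigma_lower_gt0.
  by apply: hle; rewrite /omega !le_max lexx !orbT.
Qed.

Lemma penalty_dominates i : delta i < s / (2 * Num.sqrt r) ->
  omega p c1 c1' beta (delta i) * a <= beta i -> 13 * a <= beta i.
Proof.
move=> hdel hom; have [_ h3 _ _] := omega_bounds hdel hom.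
have r1 := penalty_ratio_d_ge1.
have /andP[w1 _] := sqrt2_bounds R.
have q1 : 1 <= Num.sqrt r by rewrite -sqrtr1 ler_wsqrtr.
have ww : (Num.sqrt 2 : R) ^+ 2 = 2 by rewrite sqr_sqrtr.
have h : 4 * Num.sqrt 2 * (1 + Num.sqrt (2 * r)) * a <= beta i.
  apply: (le_trans h3); rewrite -[leRHS]mulr1 ler_pM2l//.
  have : 0 <= Num.sqrt r * delta i by rewrite mulr_ge0// sqrtr_ge0.
  by have := sigma_lower_le1; lra.
(* With [sqrt 2 >= 4 / 3] and [sqrt r >= 1] the factor is at least [16 / 3 + 8], hence above 13. *)
apply: le_trans h; rewrite ler_wpM2r// sqrtrM//.
have : Num.sqrt 2 ^+ 2 * 1 <= Num.sqrt 2 ^+ 2 * Num.sqrt r by rewrite ler_wpM2l ?sqr_ge0.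
by rewrite ww => h; nra.
Qed.

End PenaltyParameters.

(** * Descent of the potential along the iterates and summability of the measure *)

Section Convergence.
Variables (R : realType) (n p d : nat) (m : 'I_d -> nat).
Variables (A : forall i : 'I_d, 'M[R]_(n, m i)).
Variables (c1 c1' : R) (delta beta : 'I_d -> R).
Variables (X : nat -> 'I_d -> 'M[R]_(n, p)) (Z : nat -> 'M[R]_(n, p)).
Hypotheses (hd : (0 < d)%N) (hc1 : 0 < c1) (hc1' : 0 < c1').
Hypothesis hbeta : forall i, 0 < beta i.
Hypothesis hFAPS : FAPS_sequence A c1 c1' delta beta X Z.
Hypothesis hinit : forall i,
  dist_proj (X 0%N i) (Z 0%N) ^+ 2 <= 1 / (penalty_ratio beta * d%:R).
Hypothesis hdelta_small : forall i,
  0 <= delta i < sigma_lower beta / (2 * Num.sqrt (penalty_ratio beta * d%:R)).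
Hypothesis hbeta_large : forall i,
  beta i >= omega p c1 c1' beta (delta i) * nF (\mxrow_i A i) ^+ 2.

Let r := penalty_ratio beta * d%:R.
Let s := sigma_lower beta.
Let a := nF (\mxrow_i A i) ^+ 2.
Let B := \sum_i beta i.

Let a_ge0 : 0 <= a. Proof. exact: sqr_ge0. Qed.
Let delta_ge0 i : 0 <= delta i. Proof. by have /andP[] := hdelta_small i. Qed.
Let delta_lt i : delta i < s / (2 * Num.sqrt r).
Proof. by have /andP[] := hdelta_small i. Qed.
Let r_ge1 : 1 <= r := penalty_ratio_d_ge1 hd hbeta.
Let a_small i : 13 * a <= beta i.
Proof. exact: penalty_dominates (hbeta_large i). Qed.
Let Ai_le i : nF (A i) ^+ 2 <= a.
Proof.
rewrite /a frobenius_norm_mxrow.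
by apply: (ler_sum_term (x := fun i => nF (A i) ^+ 2)) => j; exact: sqr_ge0.
Qed.

Lemma faps_stiefelX k i : stiefel (X k i).
Proof. by case: k => [|k]; [exact: faps_X0 hFAPS i|case: (faps_client hFAPS k i)]. Qed.

Lemma faps_stiefelZ k : stiefel (Z k).
Proof. by case: k => [|k]; [exact: faps_Z0 hFAPS|case: (faps_center hFAPS k)]. Qed.

Definition faps_potential k := \sum_i faps_merit (A i) (beta i) (X k i) (Z k).

Lemma faps_client_progress_at k i : r * dist_proj (X k i) (Z k) ^+ 2 <= 1 ->
  3 * Num.sqrt r * dist_proj (X k.+1 i) (Z k) <= 2 * dist_proj (X k i) (Z k) /\
  c1 / 8 * s ^+ 2 * beta i * dist_proj (X k i) (Z k) ^+ 2 <=
    faps_merit (A i) (beta i) (X k i) (Z k) -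
    faps_merit (A i) (beta i) (X k.+1 i) (Z k).
Proof.
move=> hdist.
have [h1 h3 h4 h5] := omega_bounds hd hc1 a_ge0 hbeta (delta_lt i) (hbeta_large i).
apply: (faps_client_progress (Ai_le i) (hbeta i) hc1 hc1' (delta_ge0 i) r_ge1
  _ _ h1 h3 h4 h5 _ _ hdist (faps_client hFAPS k i)).
- exact: sigma_lower_gt0.
- exact: sigma_lower_sqr.
- exact: faps_stiefelX.
- exact: faps_stiefelZ.
Qed.

(** Squaring the contraction gives one factor [r] and the hypothesis a second one, which pays for
    summing over the clients in the center step. *)
Lemma faps_client_contraction k i : r * dist_proj (X k i) (Z k) ^+ 2 <= 1 ->
  9 * r ^+ 2 * dist_proj (X k.+1 i) (Z k) ^+ 2 <= 4.
Proof.
move=> hdist; have [h _] := faps_client_progress_at hdist.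
have : (3 * Num.sqrt r * dist_proj (X k.+1 i) (Z k)) ^+ 2
    <= (2 * dist_proj (X k i) (Z k)) ^+ 2.
  by rewrite lerXn2r// nnegrE ?mulr_ge0 ?sqrtr_ge0 ?dist_proj_ge0.
have r0 : 0 <= r by have := r_ge1; lra.
have -> : (3 * Num.sqrt r * dist_proj (X k.+1 i) (Z k)) ^+ 2 =
    9 * Num.sqrt r ^+ 2 * dist_proj (X k.+1 i) (Z k) ^+ 2 by ring.
rewrite (@sqr_sqrtr _ r)// => /(ler_wpM2l r0).
move: r r0 hdist => t t0 hdist; lra.
Qed.

Lemma faps_gain k : (forall i, r * dist_proj (X k i) (Z k) ^+ 2 <= 1) ->
  B / 4 * dist_proj (Z k.+1) (Z k) ^+ 2 <=
    \tr ((\sum_i faps_Q (A i) (beta i) (X k.+1 i))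
      *m (orthproj (Z k.+1) - orthproj (Z k))).
Proof.
move=> hdist; apply: (@center_gain _ _ _ _ _ A beta a (X k.+1) (Z k) (Z k.+1)).
- exact: faps_stiefelX.
- exact: faps_stiefelZ.
- exact: faps_center hFAPS k.
- exact: hbeta.
- by rewrite -frobenius_norm_mxrow.
- exact: a_small.
move=> i; have := faps_client_contraction (hdist i).
have : 1 * dist_proj (X k.+1 i) (Z k) ^+ 2 <= r ^+ 2 * dist_proj (X k.+1 i) (Z k) ^+ 2.
  by rewrite ler_wpM2r ?sqr_ge0// -[1](expr1n _ 2) lerXn2r// nnegrE; have := r_ge1; lra.
by lra.
Qed.

(** Induction on [k] for all clients at once: the center gain at step [k], whose sign is needed to
    bound the drift, depends on every client being close to the center. *)
Lemma faps_feasible k i : r * dist_proj (X k i) (Z k) ^+ 2 <= 1.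
Proof.
elim: k i => [|k IH] i.
  rewrite mulrC -ler_pdivlMr; first exact: hinit.
  by have := r_ge1; lra.
apply: (@center_feasible _ _ _ _ _ A beta a r (penalty_ratio beta) (X k.+1) (Z k)) => //.
- exact: faps_stiefelX.
- exact: faps_stiefelZ.
- exact: faps_center hFAPS k.
- by rewrite -frobenius_norm_mxrow.
- exact: penalty_ratio_ge.
- by move=> j; have [] := omega_bounds hd hc1 a_ge0 hbeta (delta_lt j) (hbeta_large j).
- by move=> j; exact: faps_client_contraction.
- apply: le_trans (faps_gain IH); rewrite mulr_ge0 ?sqr_ge0// divr_ge0//.
  by rewrite sumr_ge0// => j _; exact: ltW.
Qed.

(** The intermediate potential at the new clients and the old center splits the step; its second
    half drops by half of the center gain. *)
Lemma faps_potential_decrease k :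
  c1 / 8 * s ^+ 2 * (\sum_i beta i * dist_proj (X k i) (Z k) ^+ 2)
    + B / 8 * dist_proj (Z k.+1) (Z k) ^+ 2
  <= faps_potential k - faps_potential k.+1.
Proof.
have hclient : c1 / 8 * s ^+ 2 * (\sum_i beta i * dist_proj (X k i) (Z k) ^+ 2) <=
    faps_potential k - \sum_i faps_merit (A i) (beta i) (X k.+1 i) (Z k).
  rewrite mulr_sumr -sumrB; apply: ler_sum => i _; rewrite mulrA.
  by have [_] := faps_client_progress_at (faps_feasible k i).
have := center_merit (faps_stiefelX k.+1) (faps_stiefelZ k) (faps_center hFAPS k).
rewrite -/(faps_potential k.+1).
have := faps_gain (faps_feasible k).
by lra.
Qed.

Lemma faps_potential_ge k :
  - (\sum_i 2 * nF (A i) ^+ 2 * Num.sqrt p%:R) <= faps_potential k.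
Proof.
rewrite -sumrN; apply: ler_sum => i _.
by apply: faps_merit_ge => //; [exact: faps_stiefelX|exact: faps_stiefelZ].
Qed.

Lemma faps_measure_le_decrease : exists2 K : R, 0 < K & forall k,
  faps_measure (\mxrow_i A i) X Z k <= K * (faps_potential k - faps_potential k.+1).
Proof.
pose c := c1 / 8 * s ^+ 2; pose u := Num.sqrt p%:R + 1 : R.
pose I := \sum_i (beta i)^-1.
have c0 : 0 < c by rewrite mulr_gt0 ?divr_gt0 ?exprn_gt0 ?sigma_lower_gt0.
have B0 : 0 < B.
  rewrite /B (bigD1 (Ordinal hd))//= ltr_pwDl// sumr_ge0// => i _; exact: ltW.
have I0 : 0 <= I by rewrite sumr_ge0// => i _; rewrite invr_ge0 ltW.
have u0 : 0 < u by rewrite ltr_wpDl// sqrtr_ge0.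
have K2 : 0 <= (18 * (d%:R * B) + I) / c.
  by rewrite divr_ge0 ?(ltW c0)// addr_ge0// !mulr_ge0// ltW.
have K1 : 0 < 16 * u ^+ 2 * B by rewrite mulr_gt0// mulr_gt0 ?exprn_gt0.
(* The measure is at most [2 u^2 B^2 E^2 + (18 d B + I) V], while the decrease dominates
   [B E^2 / 8 + c V]; the two summands are the ratios of the coefficients. *)
exists (16 * u ^+ 2 * B + (18 * (d%:R * B) + I) / c); first by rewrite ltr_wpDr.
move=> k; set G := _ - _.
set V := \sum_i beta i * dist_proj (X k i) (Z k) ^+ 2.
set E := dist_proj (Z k.+1) (Z k).
pose Y := \sum_i beta i * dist_proj (X k i) (Z k).
have V0 : 0 <= V by rewrite sumr_ge0// => i _; rewrite mulr_ge0 ?sqr_ge0 ?ltW.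
have hG : c * V + B / 8 * E ^+ 2 <= G := faps_potential_decrease k.
have bB i : beta i <= B by apply: ler_sum_term => j; exact: ltW.
have hY : Y ^+ 2 <= d%:R * B * V.
  apply: (le_trans (sqr_sum_le _)); rewrite -mulrA ler_wpM2l// mulr_sumr.
  apply: ler_sum => i _; rewrite exprMn expr2 -mulrA ler_wpM2r//.
  by rewrite mulr_ge0 ?sqr_ge0 ?ltW.
have hmean : d%:R^-1 * \sum_i dist_proj (X k i) (Z k) ^+ 2 <= I * V.
  have S0 : 0 <= \sum_i dist_proj (X k i) (Z k) ^+ 2.
    by rewrite sumr_ge0// => i _; exact: sqr_ge0.
  apply: (@le_trans _ _ (\sum_i dist_proj (X k i) (Z k) ^+ 2)).
    by rewrite -[leRHS]mul1r ler_wpM2r// invf_le1 ?ltr0n// ler1n.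
  rewrite mulr_suml; apply: ler_sum => i _.
  rewrite -[leLHS](mulKf (lt0r_neq0 (hbeta i))) ler_wpM2l ?invr_ge0 ?(ltW (hbeta i))//.
  apply: (ler_sum_term (x := fun i => beta i * dist_proj (X k i) (Z k) ^+ 2)) => j.
  by rewrite mulr_ge0 ?sqr_ge0 ?ltW.
have hres : nF (stationary_residual (\mxrow_i A i) (Z k)) <= u * B * E + 3 * Y.
  apply: (le_trans (@stationary_residual_le _ _ _ _ _ A beta a (X k.+1) (Z k)
    (Z k.+1) (faps_stiefelX k.+1) (faps_stiefelZ k) (faps_center hFAPS k) hbeta _ a_small)).
    by rewrite -frobenius_norm_mxrow.
  (* The residual estimate involves the updated clients; the contraction with [sqrt r >= 1] returns
     to the distances at step [k]. *)
  rewrite lerD2l ler_wpM2l//; apply: ler_sum => i _.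
  rewrite ler_pM2l//; have [h _] := faps_client_progress_at (faps_feasible k i).
  have q1 : 1 <= Num.sqrt r by rewrite -sqrtr1 ler_wsqrtr.
  have := ler_wpM2r (dist_proj_ge0 (X k.+1 i) (Z k)) q1.
  have := dist_proj_ge0 (X k i) (Z k); have := dist_proj_ge0 (X k.+1 i) (Z k).
  by lra.
have hres2 : nF (stationary_residual (\mxrow_i A i) (Z k)) ^+ 2
    <= 2 * u ^+ 2 * B ^+ 2 * E ^+ 2 + 18 * Y ^+ 2.
  apply: (@le_trans _ _ ((u * B * E + 3 * Y) ^+ 2)).
    rewrite lerXn2r// ?nnegrE ?frobenius_norm_ge0//.
    exact: le_trans (frobenius_norm_ge0 _) hres.
  by have := sqr_ge0 (u * B * E - 3 * Y); rewrite sqrrB sqrrD !exprMn; lra.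
rewrite /faps_measure.
have BE0 : 0 <= B / 8 * E ^+ 2 by rewrite mulr_ge0 ?sqr_ge0// divr_ge0// ltW.
have cV0 : 0 <= c * V by rewrite mulr_ge0// ltW.
have hK1 : 16 * u ^+ 2 * B * (B / 8 * E ^+ 2) <= 16 * u ^+ 2 * B * G.
  by rewrite ler_wpM2l ?(ltW K1)//; lra.
have hK2 : (18 * (d%:R * B) + I) * V <= (18 * (d%:R * B) + I) / c * G.
  have -> x : x * V = x / c * (c * V) by rewrite mulrA divfK// lt0r_neq0.
  by rewrite ler_wpM2l//; lra.
by lra.
Qed.

Lemma faps_measure_ge0 k : 0 <= faps_measure (\mxrow_i A i) X Z k.
Proof.
rewrite addr_ge0 ?sqr_ge0// mulr_ge0 ?invr_ge0// sumr_ge0// => i _.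
exact: sqr_ge0.
Qed.

Lemma faps_measure_summable : exists2 C : R, 0 < C & forall N,
  \sum_(k < N) faps_measure (\mxrow_i A i) X Z k <= C.
Proof.
have [K K0 hK] := faps_measure_le_decrease.
pose b := \sum_i 2 * nF (A i) ^+ 2 * Num.sqrt p%:R.
have hsum N : \sum_(k < N) faps_measure (\mxrow_i A i) X Z k <=
    K * (faps_potential 0 - faps_potential N).
  elim: N => [|N IH]; first by rewrite big_ord0 subrr mulr0.
  by rewrite big_ord_recr/=; have := hK N; lra.
(* The telescoped sum is bounded through the lower bound [- b] of the potential; the added 1 makes
   the constant strictly positive. *)
exists (K * (faps_potential 0 + b) + 1).
  rewrite ltr_wpDl// mulr_ge0 ?(ltW K0)//.
  by have := faps_potential_ge 0; rewrite -/b; lra.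
move=> N; apply: (le_trans (hsum N)).
have : K * (faps_potential 0 - faps_potential N) <= K * (faps_potential 0 + b).
  by rewrite ler_wpM2l ?(ltW K0)//; have := faps_potential_ge N; rewrite -/b; lra.
by lra.
Qed.

Lemma faps_residual_cvg0 :
  nF (stationary_residual (\mxrow_i A i) (Z k)) ^+ 2 @[k --> \oo] --> 0.
Proof.
have [C _ hC] := faps_measure_summable.
have := bounded_series_cvg0 faps_measure_ge0 hC.
apply: (squeeze_cvgr _ (cvg_cst 0)); apply: nearW => k.
rewrite sqr_ge0/= lerDl mulr_ge0 ?invr_ge0// sumr_ge0// => i _.
exact: sqr_ge0.
Qed.

End Convergence.

Theorem theorem8 (R : realType) (n p d : nat) (m : 'I_d -> nat)
    (A : forall i : 'I_d, 'M[R]_(n, m i))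
    (c1 c1' : R) (delta beta : 'I_d -> R)
    (X : nat -> 'I_d -> 'M[R]_(n, p)) (Z : nat -> 'M[R]_(n, p))
    (hd : (0 < d)%N)
    (hnm : (n <= \sum_i m i)%N)
    (hc1 : 0 < c1)
    (hc1' : 0 < c1')
    (hdelta : forall i, 0 <= delta i < 1)
    (hbeta : forall i, 0 < beta i)
    (hFAPS : FAPS_sequence A c1 c1' delta beta X Z)
    (hinit : forall i,
       dist_proj (X 0%N i) (Z 0%N) ^+ 2 <= 1 / (penalty_ratio beta * d%:R))
    (hdelta_small : forall i,
       0 <= delta i
         < sigma_lower beta / (2 * Num.sqrt (penalty_ratio beta * d%:R)))
    (hbeta_large : forall i,
       beta i >= omega p c1 c1' beta (delta i)
                 * frobenius_norm (\mxrow_i A i) ^+ 2) :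
  [/\ cluster (Z k @[k --> \oo]) !=set0,
      forall Zstar : 'M[R]_(n, p), cluster (Z k @[k --> \oo]) Zstar ->
        first_order_stationary (\mxrow_i A i) Zstar
    & exists2 C : R, 0 < C &
        forall N : nat, (1 < N)%N ->
          \big[Num.min/faps_measure (\mxrow_i A i) X Z 0]_(k < N)
             faps_measure (\mxrow_i A i) X Z k <= C / N%:R].
Proof.
have hZ := faps_stiefelZ hFAPS.
split.
- exact: stiefel_cluster_nonempty.
- move=> Zstar; apply: cluster_stationary => //.
  exact: (faps_residual_cvg0 hd hc1 hc1' hbeta hFAPS).
have [C C0 hC] := faps_measure_summable hd hc1 hc1' hbeta hFAPS
  hinit hdelta_small hbeta_large.
exists C => // N N1; apply: (le_trans (bigmin_le_average _ (ltnW N1))).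
by rewrite ler_wpM2r ?invr_ge0.
Qed.
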